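(* Let $\Omega\subset\mathbb{H}$ be a circular domain and let $h,\tilde h\in\mathcal{R}(\Omega)$ be such that $\exp_*(h)=\exp_*(\tilde h)\in\mathcal{R}_{\mathbb{R}}(\Omega)$. (a) If $\Omega$ is a slice domain, then $h_0\equiv\tilde h_0$, $h,\tilde h\in\mathfrak{N}(\Omega)$ and $\sqrt{h_v^s}\equiv\sqrt{\tilde h_v^s}\pmod{2\pi}$. (b) If $\Omega$ is a product domain, then there exists $n\in\mathbb{Z}$ such that $h_0=\tilde h_0+\pi n\mathcal{J}$; moreover $h,\tilde h\in\mathfrak{N}(\Omega)$ and $\sqrt{h_v^s}\equiv\sqrt{\tilde h_v^s}+n\pi\pmod{2\pi}$.
   Context: $\mathbb{H}$ is the algebra of quaternions; $q=q_0+q_v$ with $q_0$ real and $q_v$ purely imaginary, $q^c=q_0-q_v$, $\mathbb{S}=\{I\in\mathbb{H}: I^2=-1\}$, $\mathbb{C}_I=\mathbb{R}+\mathbb{R}I$, $\mathbb{S}_q=\{q_0+\|q_v\|J: J\in\mathbb{S}\}$, $\Omega_I=\Omega\cap\mathbb{C}_I$. A domain (nonempty connected open set) $\Omega\subset\mathbb{H}$ is circular if $\mathbb{S}_q\subset\Omega$ for all $q\in\Omega$; it is a slice domain if $\Omega\cap\mathbb{R}\neq\emptyset$ and a product domain if $\Omega\cap\mathbb{R}=\emptyset$. A function $f:\Omega\to\mathbb{H}$ is slice regular if $f(\alpha+I\beta)=F_0(\alpha+\sqrt{-1}\beta)+I F_1(\alpha+\sqrt{-1}\beta)$ for all $I\in\mathbb{S}$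 and $\alpha,\beta\in\mathbb{R}$ with $\alpha+I\beta\in\Omega$, where $F_0,F_1:\{\alpha+\sqrt{-1}\beta:\alpha+I\beta\in\Omega\}\to\mathbb{H}$ are $C^1$, $F_0(\bar z)=F_0(z)$, $F_1(\bar z)=-F_1(z)$ and $\partial_\alpha F_0=\partial_\beta F_1$, $\partial_\beta F_0=-\partial_\alpha F_1$. $\mathcal{R}(\Omega)$ is the set of slice regular functions; $f\in\mathcal{R}(\Omega)$ is slice preserving if $f(\Omega_I)\subset\mathbb{C}_I$ for all $I\in\mathbb{S}$, and $\mathcal{R}_{\mathbb{R}}(\Omega)$ is the set of slice preserving functions. The $*$-product is $(f*g)(q)=0$ if $f(q)=0$, and $(f*g)(q)=f(q)\,g(f(q)^{-1}qf(q))$ otherwise; with pointwise sum it makes $\mathcal{R}(\Omega)$ an associative algebra. The slice conjugate $f^c$ is the function induced by $(F_0^c,F_1^c)$ (pointwise conjugates), and $f^s=f*f^c\in\mathcal{R}_{\mathbb{R}}(\Omega)$. Every $f\in\mathcal{R}(\Omega)$ is uniquely $f=f_0+f_1i+f_2j+f_3k$ with $f_\ell\in\mathcal{R}_{\mathbb{R}}(\Omega)$; $f_0$ is its real part, $f_v=f-f_0$ its vector part, and $f_v^s:=(f_v)^s=f_1^2+f_2^2+f_3^2$. $\exp_*(f)=\sum_{n\ge0}f^{*n}/n!$, with $f^{*n}$ the $n$-th $*$-power. $\mathcal{J}:\mathbb{H}\setminus\mathbb{R}\to\mathbb{S}$ is the slice preserving regular function $\mathcal{J}(q)=q_v/\|q_v\|$.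 $\mathfrak{N}(\Omega):=\{f\in\mathcal{R}(\Omega): \exists\, m\in\mathbb{Z}\setminus\{0\},\ f_v^s\equiv m^2\pi^2\}\cup\mathcal{R}_{\mathbb{R}}(\Omega)$. If $f\in\mathfrak{N}(\Omega)$, then $f_v^s$ is a constant $m^2\pi^2$ with $m\in\mathbb{Z}$, and $\sqrt{f_v^s}$ denotes a constant square root, i.e. $\pm m\pi$ (the choice of sign is immaterial modulo $2\pi$). *)

(* Defs.v *)
From HB Require Import structures.
From mathcomp Require Import all_boot all_order all_algebra.
From mathcomp Require Import all_classical all_reals all_analysis.
From mathcomp Require Import ring lra.

Set Implicit Arguments.
Unset Strict Implicit.
Unset Printing Implicit Defensive.

Import Order.TTheory GRing.Theory Num.Theory.
Import numFieldNormedType.Exports.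

Local Open Scope classical_set_scope.
Local Open Scope ring_scope.

(* The row vector (a, b, c, d) encodes a + b i + c j + d k.  Row vectors are
   used because, unlike iterated products, they carry no ring structure that
   could compete with Hamilton's. *)
Definition quat (R : realType) : Type := 'rV[R]_4.

HB.instance Definition _ (R : realType) :=
  NormedModule.copy (quat R) 'rV[R]_4.

HB.instance Definition _ (R : realType) := Complete.copy (quat R) 'rV[R]_4.

Section QuatRing.
Variable R : realType.
Implicit Types p q r : quat R.

Definition mkq (a b c d : R) : quat R := \row_(i < 4) [:: a; b; c; d]`_i.

Definition q_re q : R := q 0 0.
Definition q_i q : R := q 0 1.
Definition q_j q : R := q 0 2.
Definition q_k q : R := q 0 3.

Lemma mkqK (a b c d : R) :
  [/\ q_re (mkq a b c d) = a, q_i (mkq a b c d) = b,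
      q_j (mkq a b c d) = c & q_k (mkq a b c d) = d].
Proof. by split; rewrite /q_re /q_i /q_j /q_k mxE. Qed.

Lemma quatP p q :
  [/\ q_re p = q_re q, q_i p = q_i q, q_j p = q_j q & q_k p = q_k q] -> p = q.
Proof.
move=> [h0 h1 h2 h3]; apply/rowP => -[[|[|[|[|//]]]] hi].
- by rewrite (_ : Ordinal hi = 0)//; exact/val_inj.
- by rewrite (_ : Ordinal hi = 1)//; exact/val_inj.
- by rewrite (_ : Ordinal hi = 2)//; exact/val_inj.
- by rewrite (_ : Ordinal hi = 3)//; exact/val_inj.
Qed.

Lemma quatE q : q = mkq (q_re q) (q_i q) (q_j q) (q_k q).
Proof. by apply: quatP; split; rewrite /q_re /q_i /q_j /q_k mxE. Qed.

Lemma mkqD (a1 b1 c1 d1 a2 b2 c2 d2 : R) :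
  mkq a1 b1 c1 d1 + mkq a2 b2 c2 d2 =
  mkq (a1 + a2) (b1 + b2) (c1 + c2) (d1 + d2).
Proof. by apply: quatP; split; rewrite /q_re /q_i /q_j /q_k !mxE. Qed.

Lemma mkqZ (k a b c d : R) :
  k *: mkq a b c d = mkq (k * a) (k * b) (k * c) (k * d).
Proof. by apply: quatP; split; rewrite /q_re /q_i /q_j /q_k !mxE. Qed.

Lemma mkq0 : 0 = mkq 0 0 0 0.
Proof. by apply: quatP; split; rewrite /q_re /q_i /q_j /q_k !mxE. Qed.

Definition qone : quat R := mkq 1 0 0 0.

(* Hamilton's product, from i^2 = j^2 = k^2 = ijk = -1. *)
Definition qmul p q : quat R :=
  mkq (q_re p * q_re q - q_i p * q_i q - q_j p * q_j q - q_k p * q_k q)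
      (q_re p * q_i q + q_i p * q_re q + q_j p * q_k q - q_k p * q_j q)
      (q_re p * q_j q - q_i p * q_k q + q_j p * q_re q + q_k p * q_i q)
      (q_re p * q_k q + q_i p * q_j q - q_j p * q_i q + q_k p * q_re q).

Definition qsqn q : R := q_re q ^+ 2 + q_i q ^+ 2 + q_j q ^+ 2 + q_k q ^+ 2.

Definition qconj q : quat R := mkq (q_re q) (- q_i q) (- q_j q) (- q_k q).

Definition qinv q : quat R := (qsqn q)^-1 *: qconj q.

Lemma qmulE (a1 b1 c1 d1 a2 b2 c2 d2 : R) :
  qmul (mkq a1 b1 c1 d1) (mkq a2 b2 c2 d2) =
  mkq (a1 * a2 - b1 * b2 - c1 * c2 - d1 * d2)
      (a1 * b2 + b1 * a2 + c1 * d2 - d1 * c2)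
      (a1 * c2 - b1 * d2 + c1 * a2 + d1 * b2)
      (a1 * d2 + b1 * c2 - c1 * b2 + d1 * a2).
Proof.
rewrite /qmul; have [-> -> -> ->] := mkqK a1 b1 c1 d1.
by have [-> -> -> ->] := mkqK a2 b2 c2 d2.
Qed.

Lemma qconjE (a b c d : R) : qconj (mkq a b c d) = mkq a (- b) (- c) (- d).
Proof. by rewrite /qconj; have [-> -> -> ->] := mkqK a b c d. Qed.

Lemma qsqnE (a b c d : R) :
  qsqn (mkq a b c d) = a ^+ 2 + b ^+ 2 + c ^+ 2 + d ^+ 2.
Proof. by rewrite /qsqn; have [-> -> -> ->] := mkqK a b c d. Qed.

Lemma qmulA : associative qmul.
Proof.
move=> p q r; rewrite (quatE p) (quatE q) (quatE r) !qmulE.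
by congr mkq; ring.
Qed.

Lemma qmul1q : left_id qone qmul.
Proof. by move=> p; rewrite {1}(quatE p) qmulE [RHS]quatE; congr mkq; ring. Qed.

Lemma qmulq1 : right_id qone qmul.
Proof. by move=> p; rewrite {1}(quatE p) qmulE [RHS]quatE; congr mkq; ring. Qed.

Lemma qmulDl : left_distributive qmul +%R.
Proof.
move=> p q r; rewrite (quatE p) (quatE q) (quatE r) !qmulE !mkqD qmulE.
by congr mkq; ring.
Qed.

Lemma qmulDr : right_distributive qmul +%R.
Proof.
move=> p q r; rewrite (quatE p) (quatE q) (quatE r) !qmulE !mkqD qmulE.
by congr mkq; ring.
Qed.

Lemma qone_neq0 : qone != 0.
Proof.
apply/eqP => /(congr1 q_re); rewrite mkq0 /qone.
have [-> _ _ _] := mkqK 1 0 0 0; have [-> _ _ _] := mkqK 0 0 0 0.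
by move/eqP; rewrite oner_eq0.
Qed.

HB.instance Definition _ :=
  GRing.Zmodule_isNzRing.Build (quat R) qmulA qmul1q qmulq1 qmulDl qmulDr
    qone_neq0.

Lemma mkqM (a1 b1 c1 d1 a2 b2 c2 d2 : R) :
  mkq a1 b1 c1 d1 * mkq a2 b2 c2 d2 =
  mkq (a1 * a2 - b1 * b2 - c1 * c2 - d1 * d2)
      (a1 * b2 + b1 * a2 + c1 * d2 - d1 * c2)
      (a1 * c2 - b1 * d2 + c1 * a2 + d1 * b2)
      (a1 * d2 + b1 * c2 - c1 * b2 + d1 * a2).
Proof. exact: qmulE. Qed.

Lemma mkq1 : 1 = mkq 1 0 0 0.
Proof. by []. Qed.

Lemma qscaleAl (k : R) p q : k *: (p * q) = k *: p * q.
Proof.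
rewrite (quatE p) (quatE q) mkqM !mkqZ mkqM.
by congr mkq; ring.
Qed.

HB.instance Definition _ := GRing.Lmodule_isLalgebra.Build R (quat R) qscaleAl.

Lemma qscaleAr (k : R) p q : k *: (p * q) = p * (k *: q).
Proof.
rewrite (quatE p) (quatE q) mkqM !mkqZ mkqM.
by congr mkq; ring.
Qed.

HB.instance Definition _ := GRing.Lalgebra_isAlgebra.Build R (quat R) qscaleAr.

Lemma qsqn_eq0 q : (qsqn q == 0) = (q == 0).
Proof.
apply/idP/idP => [/eqP h|/eqP ->]; last first.
  by rewrite mkq0 qsqnE !expr0n /= !addr0.
have [h0 h1 h2 h3] : [/\ 0 <= q_re q ^+ 2, 0 <= q_i q ^+ 2,
    0 <= q_j q ^+ 2 & 0 <= q_k q ^+ 2] by split; exact: sqr_ge0.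
rewrite /qsqn in h; apply/eqP; rewrite (quatE q) mkq0.
by congr mkq; apply/eqP; rewrite -sqrf_eq0; apply/eqP; lra.
Qed.

Lemma qconj_mul q : qconj q * q = (qsqn q)%:A.
Proof.
rewrite {2}(quatE q) mkqM mkq1 mkqZ /qsqn.
by congr mkq; ring.
Qed.

Lemma qmul_conj q : q * qconj q = (qsqn q)%:A.
Proof.
rewrite {1}(quatE q) mkqM mkq1 mkqZ /qsqn.
by congr mkq; ring.
Qed.

Definition qunit : pred (quat R) := fun q => q != 0.

Lemma qmulVq : {in qunit, left_inverse 1 qinv *%R}.
Proof.
move=> q q0; rewrite /qinv -scalerAl qconj_mul scalerA mulVf ?scale1r//.
by rewrite qsqn_eq0.
Qed.

Lemma qmulqV : {in qunit, right_inverse 1 qinv *%R}.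
Proof.
move=> q q0; rewrite /qinv -scalerAr qmul_conj scalerA mulVf ?scale1r//.
by rewrite qsqn_eq0.
Qed.

Lemma qunitP p q : q * p = 1 /\ p * q = 1 -> qunit p.
Proof.
move=> [h _]; apply/eqP => p0; move: h; rewrite p0 mulr0 => /esym/eqP.
by rewrite oner_eq0.
Qed.

Lemma qinv_out : {in [predC qunit], qinv =1 id}.
Proof.
move=> q; rewrite inE negbK => /eqP ->.
by rewrite /qinv mkq0 qconjE oppr0 -mkq0 scaler0.
Qed.

HB.instance Definition _ :=
  GRing.NzRing_hasMulInverse.Build (quat R) qmulVq qmulqV qunitP qinv_out.

End QuatRing.

Section SliceRegular.
Variable R : realType.
Local Notation H := (quat R).
Implicit Types (q I : H) (f g : H -> H) (Omega : set H).

Definition qi : H := mkq 0 1 0 0.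
Definition qj : H := mkq 0 0 1 0.
Definition qk : H := mkq 0 0 0 1.

Definition qvec q : H := q - (q_re q)%:A.
Definition qnorm q : R := Num.sqrt (qsqn q).

Definition unit_sphere : set H := [set I | I * I = -1].

Definition slice_plane I : set H := [set q | exists a b : R, q = a%:A + b *: I].

Definition sphere_of q : set H :=
  [set (q_re q)%:A + qnorm (qvec q) *: J | J in unit_sphere].

Definition real_axis : set H := range (fun a : R => a%:A : H).

Definition domain Omega := [/\ Omega !=set0, connected Omega & open Omega].

Definition circular Omega := forall q, Omega q -> sphere_of q `<=` Omega.

Definition slice_domain Omega := Omega `&` real_axis !=set0.

Definition product_domain Omega := Omega `&` real_axis = set0.

(* The complex number alpha + sqrt(-1) beta is encoded as (alpha, beta). *)
Definition stem_domain Omega : set (R * R) :=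
  [set z | exists2 I, unit_sphere I & Omega (z.1%:A + z.2 *: I)].

Definition d_alpha (F : R * R -> H) : R * R -> H := 'D_((1, 0) : R * R) F.
Definition d_beta (F : R * R -> H) : R * R -> H := 'D_((0, 1) : R * R) F.

Definition C1_on (D : set (R * R)) (F : R * R -> H) :=
  forall z, D z ->
    [/\ derivable F z (1, 0), derivable F z (0, 1),
        {for z, continuous (d_alpha F)} & {for z, continuous (d_beta F)}].

Definition stem (D : set (R * R)) (F0 F1 : R * R -> H) :=
  [/\ C1_on D F0, C1_on D F1 &
      forall z, D z ->
        [/\ F0 (z.1, - z.2) = F0 z, F1 (z.1, - z.2) = - F1 z,
            d_alpha F0 z = d_beta F1 z & d_beta F0 z = - d_alpha F1 z]].

Definition induced Omega (F0 F1 : R * R -> H) f :=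
  forall I (a b : R), unit_sphere I -> Omega (a%:A + b *: I) ->
    f (a%:A + b *: I) = F0 (a, b) + I * F1 (a, b).

Definition slice_regular Omega f :=
  exists F0 F1, stem (stem_domain Omega) F0 F1 /\ induced Omega F0 F1 f.

Definition slice_preserving Omega f :=
  slice_regular Omega f /\
  forall I, unit_sphere I ->
    f @` (Omega `&` slice_plane I) `<=` slice_plane I.

Definition star f g : H -> H :=
  fun q => if f q == 0 then 0 else f q * g ((f q)^-1 * q * f q).

Definition star_pow f (n : nat) : H -> H := iter n (star f) (fun=> 1).

(* The series converges locally uniformly, so that its sum is also its
   pointwise sum. *)
Definition star_exp f : H -> H :=
  fun q => lim (series (fun n => n`!%:R^-1 *: star_pow f n q : H) @ \oo).

(* The slice conjugate and the real part are uniquely determined on Omega;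
   their values outside of Omega are irrelevant. *)
Definition is_slice_conj Omega f g :=
  exists F0 F1, [/\ stem (stem_domain Omega) F0 F1, induced Omega F0 F1 f &
    induced Omega (fun z => qconj (F0 z)) (fun z => qconj (F1 z)) g].

Definition slice_conj Omega f : H -> H :=
  xget (fun=> 0) [set g | is_slice_conj Omega f g].

Definition symmetrization Omega f : H -> H := star f (slice_conj Omega f).

Definition is_real_part Omega f f0 :=
  exists f1 f2 f3,
    [/\ slice_preserving Omega f0, slice_preserving Omega f1,
        slice_preserving Omega f2, slice_preserving Omega f3 &
        {in Omega, forall q, f q = f0 q + f1 q * qi + f2 q * qj + f3 q * qk}].

Definition real_part Omega f : H -> H :=
  xget (fun=> 0) [set f0 | is_real_part Omega f f0].

Definition vector_part Omega f : H -> H := fun q => f q - real_part Omega f q.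

Definition vector_sym Omega f : H -> H :=
  symmetrization Omega (vector_part Omega f).

Definition calJ : H -> H := fun q => (qnorm (qvec q))^-1 *: qvec q.

Definition frakN Omega : set (H -> H) :=
  [set f | slice_regular Omega f /\
     exists m : int, m != 0 /\
       {in Omega, forall q, vector_sym Omega f q = ((m%:~R * pi) ^+ 2)%:A}]
  `|` slice_preserving Omega.

(* s is one of the two constant square roots +/- m pi of f_v^s. *)
Definition const_sqrt Omega f (s : R) :=
  (exists m : int, s = m%:~R * pi) /\
  {in Omega, forall q, vector_sym Omega f q = (s ^+ 2)%:A}.

Definition eqmod_2pi (x y : R) := exists k : int, x = y + k%:~R * (2 * pi).

(* sqrt(f_v^s) = sqrt(g_v^s) + c modulo 2 pi: the constant square roots exist,
   and the congruence holds for every choice of their signs. *)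
Definition sqrt_congr Omega f g (c : R) :=
  [/\ exists s, const_sqrt Omega f s, exists t, const_sqrt Omega g t &
      forall s t, const_sqrt Omega f s -> const_sqrt Omega g t ->
        eqmod_2pi s (t + c)].

End SliceRegular.

(* Main.v *)
From HB Require Import structures.
Require Import Defs.
From mathcomp Require Import all_boot all_order all_algebra.
From mathcomp Require Import all_classical all_reals all_analysis.
From mathcomp Require Import complex ring lra.

(** On a sphere [a + b S] a slice function is [I |-> P + I Q], and the star product
    multiplies the corresponding complexified quaternions [P + sqrt(-1) Q]
    ([slice_at_star]).  Write the value of [h] at the stem point [z = (a, b)] as
    [w + v], with [w] a complex number, the value of [h_0], and [v] a complex
    vector; then [v * v = - s], where the complex number [s] is the value of the
    symmetrized vector part ([slice_at_vector_sym]).  Therefore the star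
    exponential has the value

      [e^w (cos (sqrt s) + (sin (sqrt s) / sqrt s) v)],

    which is a complex number, as slice preservation demands, only if [v = 0] or
    [s = (m pi)^2] with [m] a nonzero integer.  In both cases [s = (m pi)^2] for an
    integer [m], the value is [(-1)^m e^w], and [m = 0] implies [v = 0]
    ([star_exp_slice_preserving]).

    To pass from one sphere to all of [Omega], note that [s] takes its values in a
    discrete set, hence is constant because [Omega] is connected
    ([star_exp_vec_constant]).  If the constant is 0 then [v] vanishes everywhere
    and [h] is slice preserving; otherwise the symmetrized vector part is
    [m^2 pi^2] with [m] nonzero.

    Given two logarithms, [(-1)^m e^w = (-1)^mt e^w'] shows that [w - w'] is
    [n pi sqrt(-1)] with [n] congruent to [mt - m] modulo 2, and [n] is constant on
    the points with [b >= 0] for the same reason ([log_difference]).  Since [calJ]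
    plays the role of [sqrt(-1)] at these points, this is the difference of the
    real parts in a product domain.  On a slice domain the imaginary parts of
    [w] and [w'] vanish at a real point, so that [n = 0]. *)

Set Implicit Arguments.
Unset Strict Implicit.
Unset Printing Implicit Defensive.

Import Order.TTheory GRing.Theory Num.Theory.
Import numFieldNormedType.Exports.

Local Open Scope classical_set_scope.
Local Open Scope ring_scope.

(** * The complex exponential and exponential generating series *)

Section ComplexExponential.
Local Open Scope complex_scope.
Variable R : realType.
Implicit Types (z w : R[i]) (u v : nat -> R[i]).

Local Notation re := (@complex.Re R).
Local Notation im := (@complex.Im R).

Lemma reM z w : re (z * w) = re z * re w - im z * im w.
Proof. by case: z w => [a b] [c d]. Qed.

Lemma imM z w : im (z * w) = re z * im w + im z * re w.
Proof. by case: z w => [a b] [c d]. Qed.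

Definition cexp z : R[i] :=
  (expR (re z) * cos (im z)) +i* (expR (re z) * sin (im z)).

Lemma cexpD z w : cexp (z + w) = cexp z * cexp w.
Proof.
case: z w => [a b] [c d]; apply/eqP; rewrite eq_complex /cexp /=.
by rewrite expRD cosD sinD; apply/andP; split; apply/eqP; ring.
Qed.

Lemma cexp0 : cexp 0 = 1.
Proof. by rewrite /cexp /= expR0 cos0 sin0 mul1r mulr0. Qed.

Lemma cexpN z : cexp z * cexp (- z) = 1.
Proof. by rewrite -cexpD subrr cexp0. Qed.

Lemma cexp_neq0 z : cexp z != 0.
Proof.
apply/eqP => z0; have := cexpN z; rewrite z0 mul0r => /esym/eqP.
by rewrite oner_eq0.
Qed.

Lemma cexp_pi (m : int) : cexp (0 +i* (m%:~R * pi)) = (-1) ^ m.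
Proof.
have nat_case (n : nat) : cexp (0 +i* (n%:R * pi)) = (-1) ^+ n.
  elim: n => [|n IHn]; first by rewrite mul0r cexp0.
  have -> : (0 +i* (n.+1%:R * pi) : R[i]) = 0 +i* (n%:R * pi) + 0 +i* pi.
    apply/eqP; rewrite eq_complex /= addr0 eqxx /=.
    by rewrite -natr1 mulrDl mul1r.
  rewrite cexpD IHn exprSr /cexp /= expR0 cospi sinpi mul1r mulr0.
  by congr (_ * _); apply/eqP; rewrite eq_complex /= oppr0 !eqxx.
case: m => n; first exact: nat_case.
have -> : (0 +i* ((Negz n)%:~R * pi) : R[i]) = - (0 +i* (n.+1%:R * pi)).
  by apply/eqP; rewrite eq_complex /= oppr0 eqxx /= NegzE mulrNz mulNr.
apply: (mulfI (cexp_neq0 (0 +i* (n.+1%:R * pi)))).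
by rewrite cexpN nat_case NegzE -exprnN mulfV// expf_neq0// oppr_eq0 oner_eq0.
Qed.

(** Subtracting the right multiple of [2 * pi] brings the imaginary part into
    the range [0 <= y < 2 * pi], where the cosine takes the value 1 only at 0. *)
Lemma cexp_eq1 z : cexp z = 1 -> exists k : int, z = 0 +i* ((k * 2)%:~R * pi).
Proof.
have tpi : 0 < 2 * pi :> R by rewrite mulr_gt0// pi_gt0.
pose k := Num.floor (im z / (2 * pi)).
pose w := z - 0 +i* ((k * 2)%:~R * pi).
have -> : z = w + 0 +i* ((k * 2)%:~R * pi) by rewrite /w subrK.
rewrite cexpD cexp_pi mulrC -exprz_exp exprzAC -exprnP sqrrN expr1n.
rewrite exp1rz mul1r => w1.
have : 0 <= im w < 2 * pi.
  rewrite /w raddfB /= subr_ge0 ltrBlDr intrM -mulrA -ler_pdivlMr//.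
  rewrite -{2}[2 * pi]mul1r -mulrDl -ltr_pdivrMr// -/k.
  by have := floor_itv (im z / (2 * pi)); rewrite -/k intrD addrC.
case: w w1 => a b /eqP; rewrite eq_complex /cexp /=.
move=> /andP[/eqP h1 /eqP h2] /andP[b0 b2].
have sb0 : sin b = 0.
  by move/eqP: h2; rewrite mulf_eq0 gt_eqF ?expR_gt0//= => /eqP.
have cb1 : cos b = 1.
  have := sin0cos1 sb0; move: h1; have := expR_gt0 a.
  by case: (ltP (cos b) 0) => c0 e0 h1; [nra|rewrite ger0_norm].
move: h1; rewrite cb1 mulr1 -expR0 => /expR_inj a0.
suff -> : b = 0 by exists k; rewrite a0 add0r.
have pi0 := pi_gt0 R.
have cos1 (x : R) : 0 <= x <= pi -> cos x = 1 -> x = 0.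
  move=> xpi; rewrite -cos0; apply: cos_inj; rewrite ?in_itv/= ?xpi//.
  by rewrite lexx ltW.
have [bpi|pib] := leP b pi; first by apply: cos1; rewrite ?b0.
suff : 2 * pi - b = 0 by lra.
apply: cos1; first by lra.
by rewrite cosB mulr_natl cos2pi sin2pi cb1 sb0 mulr0 addr0 mulr1.
Qed.

(** Convergence of the exponential generating series of [u] to [l] is stated
    separately for the real and imaginary parts, as two real series: these are
    what the four real coordinates of a star exponential are built from. *)
Definition egf_sum u l :=
  series (fun n => n`!%:R^-1 * re (u n)) @ \oo --> re l /\
  series (fun n => n`!%:R^-1 * im (u n)) @ \oo --> im l.

Lemma eq_egf_sum u v l : u =1 v -> egf_sum v l -> egf_sum u l.
Proof. by move=> /funext ->. Qed.

Lemma egf_sumD u v l m : egf_sum u l -> egf_sum v m ->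
  egf_sum (fun n => u n + v n) (l + m).
Proof.
move=> [ur ui] [vr vi]; split.
  rewrite [series _](_ : _ = series (fun n => n`!%:R^-1 * re (u n)) +
    series (fun n => n`!%:R^-1 * re (v n))).
    by rewrite raddfD; exact: cvgD.
  apply/funext => n; rewrite /series /= !fctE -big_split /=.
  by apply: eq_bigr => k _; rewrite raddfD mulrDr.
rewrite [series _](_ : _ = series (fun n => n`!%:R^-1 * im (u n)) +
  series (fun n => n`!%:R^-1 * im (v n))).
  by rewrite raddfD; exact: cvgD.
apply/funext => n; rewrite /series /= !fctE -big_split /=.
by apply: eq_bigr => k _; rewrite raddfD mulrDr.
Qed.

Lemma egf_sumM c u l : egf_sum u l -> egf_sum (fun n => c * u n) (c * l).
Proof.
case: c l => [a b] [l1 l2] [/= ur ui]; split => /=.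
  rewrite [series _](_ : _ =
    (fun n => a * series (fun n => n`!%:R^-1 * re (u n)) n) -
    (fun n => b * series (fun n => n`!%:R^-1 * im (u n)) n)); last first.
    apply/funext => n; rewrite /series /= !fctE !mulr_sumr -sumrB.
    by apply: eq_bigr => k _; case: (u k) => x y /=; ring.
  by apply: cvgB; apply: cvgMl_tmp.
rewrite [series _](_ : _ =
  (fun n => a * series (fun n => n`!%:R^-1 * im (u n)) n) +
  (fun n => b * series (fun n => n`!%:R^-1 * re (u n)) n)); last first.
  apply/funext => n; rewrite /series /= !fctE !mulr_sumr -big_split/=.
  by apply: eq_bigr => k _; case: (u k) => x y /=; ring.
by apply: cvgD; apply: cvgMl_tmp.
Qed.

Lemma norm_complex_expr z n : `|re (z ^+ n)| + `|im (z ^+ n)| <=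
  (`|re z| + `|im z|) ^+ n.
Proof.
elim: n => [|n IHn]; first by rewrite !expr0 /= normr1 normr0 addr0.
rewrite !exprS; apply: le_trans (ler_wpM2l _ IHn); last exact: addr_ge0.
case: z (z ^+ n) {IHn} => [a b] [c d] /=.
have := ler_normB (a * c) (b * d); have := ler_normD (a * d) (b * c).
rewrite !normrM; lra.
Qed.

Lemma is_cvg_pseries_norm_le (c : R^nat) (C M x : R) : 0 <= M ->
  (forall n, `|c n| <= C * (n`!%:R^-1 * M ^+ n)) -> cvgn (pseries c x).
Proof.
move=> M0 cM.
have cE n : `|c n * x ^+ n| <= C * exp_coeff (M * `|x|) n.
  rewrite /exp_coeff /= exprMn normrM normrX.
  rewrite [_ * _ / _]mulrAC [X in _ <= C * (X * _)]mulrC mulrA.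
  by rewrite ler_wpM2r ?exprn_ge0//.
apply: normed_cvg.
apply: (@series_le_cvg _ _ (C *: exp_coeff (M * `|x|))) => [n|n|n|].
- by rewrite /= normr_ge0.
- exact: le_trans (normr_ge0 _) (cE n).
- exact: cE.
- by apply: is_cvg_seriesZ; exact: is_cvg_series_exp_coeff.
Qed.

Lemma pseries_at0 (c : R^nat) : limn (pseries c 0) = c 0%N.
Proof.
apply: lim_near_cst => //; exists 1%N => // -[//|n] _.
rewrite /pseries /series /= big_nat_recl//= expr0 mulr1.
rewrite big1_seq ?addr0// => k _.
by rewrite exprS mul0r mulr0.
Qed.

(** The curve [exp (- (a + b i) x) (C x + i S x)], whose real and imaginary
    parts are the functions [f] and [g] of the proof, has derivative zero, hence
    keeps the value it has at 0. *)
Lemma linear_ode_expR (C S : R -> R) (a b : R) :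
  (forall x, is_derive x (1 : R) C (a * C x - b * S x)) ->
  (forall x, is_derive x (1 : R) S (b * C x + a * S x)) ->
  C 0 = 1 -> S 0 = 0 -> C 1 = expR a * cos b /\ S 1 = expR a * sin b.
Proof.
move=> dC dS C0 S0.
have dlin k (x : R) : is_derive x (1 : R) (fun t => k * t : R) k.
  by apply: trigger_derive; rewrite /GRing.scale/= mulr1.
have dexp (x : R) : is_derive x (1 : R) (fun t => expR (- a * t))
      (- a * expR (- a * x)).
  have := @is_derive1_comp _ expR (fun t => - a * t) x _ _
    (is_derive_expR _) (dlin _ _).
  by rewrite /GRing.scale/= mulrC.
have dcos (x : R) : is_derive x (1 : R) (fun t => cos (b * t))
      (- (b * sin (b * x))).
  have := @is_derive1_comp _ cos (fun t => b * t) x _ _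
    (is_derive_cos _) (dlin _ _).
  by rewrite /GRing.scale/= mulNr mulrC.
have dsin (x : R) : is_derive x (1 : R) (fun t => sin (b * t))
      (b * cos (b * x)).
  have := @is_derive1_comp _ sin (fun t => b * t) x _ _
    (is_derive_sin _) (dlin _ _).
  by rewrite /GRing.scale/= mulrC.
pose f (x : R) := expR (- a * x) * (cos (b * x) * C x + sin (b * x) * S x).
pose g (x : R) := expR (- a * x) * (cos (b * x) * S x - sin (b * x) * C x).
have df (x : R) : is_derive x (1 : R) f 0.
  apply: (is_derive_eq (is_deriveM (dexp x)
    (is_deriveD (is_deriveM (dcos x) (dC x)) (is_deriveM (dsin x) (dS x))))).
  rewrite !fctE /GRing.scale/=. ring.
have dg (x : R) : is_derive x (1 : R) g 0.
  apply: (is_derive_eq (is_deriveM (dexp x)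
    (is_deriveB (is_deriveM (dcos x) (dS x)) (is_deriveM (dsin x) (dC x))))).
  rewrite !fctE /GRing.scale/=. ring.
have := is_derive_0_is_cst 1 0 df; have := is_derive_0_is_cst 1 0 dg.
rewrite /f /g !mulr0 !mulr1 expR0 cos0 sin0 C0 S0 expRN => g1 f1.
have e0 := expR_gt0 a; have cs := cos2Dsin2 b.
have {}f1 : cos b * C 1 + sin b * S 1 = expR a.
  apply: (mulfI (invr_neq0 (lt0r_neq0 e0))).
  by rewrite f1 mulVf ?gt_eqF//; ring.
have {}g1 : cos b * S 1 - sin b * C 1 = 0.
  by apply: (mulfI (invr_neq0 (lt0r_neq0 e0))); rewrite g1; ring.
move: (C 1) (S 1) (cos b) (sin b) cs f1 g1 => x y c s cs f1 g1; split.
  transitivity ((c ^+ 2 + s ^+ 2) * x); first by rewrite cs mul1r.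
  transitivity (c * (c * x + s * y) - s * (c * y - s * x)); first by ring.
  by rewrite f1 g1; ring.
transitivity ((c ^+ 2 + s ^+ 2) * y); first by rewrite cs mul1r.
transitivity (s * (c * x + s * y) + c * (c * y - s * x)); first by ring.
by rewrite f1 g1; ring.
Qed.

(** Both coordinates of [x |-> sum (x z)^n / n!] are real power series of the
    form [G p q]; differentiating them term by term multiplies [z^n] by [z], so
    they solve the linear system of [linear_ode_expR]. *)
Lemma egf_sum_cexp z : egf_sum (fun n => z ^+ n) (cexp z).
Proof.
pose a := re z; pose b := im z.
(* [L p q] is stable under [pseries_diffs], which the coordinates alone are
   not: this is why real linear forms of [z ^+ n] are considered. *)
pose L p q : R^nat := fun n => n`!%:R^-1 * (p * re (z ^+ n) + q * im (z ^+ n)).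
have diffL p q : pseries_diffs (L p q) = L (p * a + q * b) (q * a - p * b).
  apply/funext => n; rewrite /pseries_diffs /L factS natrM invfM !mulrA.
  rewrite divff ?mul1r ?pnatr_eq0//; congr (_ * _).
  by rewrite exprS reM imM /a /b; ring.
have cvgL p q x : cvgn (pseries (L p q) x).
  apply: (@is_cvg_pseries_norm_le _ (`|p| + `|q|) (`|a| + `|b|)) => [|n].
    exact: addr_ge0.
  have := norm_complex_expr z n; rewrite -/a -/b; set M := (_ ^+ n).
  rewrite /L normrM ger0_norm ?invr_ge0// mulrCA => zM.
  apply: ler_wpM2l; first by rewrite invr_ge0.
  apply: le_trans (ler_normD _ _) _; rewrite !normrM.
  have r0 := normr_ge0 (re (z ^+ n)); have i0 := normr_ge0 (im (z ^+ n)).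
  have p0 := normr_ge0 p; have q0 := normr_ge0 q.
  by rewrite mulrDl lerD// ler_wpM2l//; lra.
pose G p q x := limn (pseries (L p q) x).
have dG p q (x : R) : is_derive x 1 (G p q)
      (G (p * a + q * b) (q * a - p * b) x).
  rewrite /G -diffL; apply: (@pseries_snd_diffs _ _ (`|x| + 1)).
  - exact: cvgL.
  - by rewrite diffL; exact: cvgL.
  - by rewrite !diffL; exact: cvgL.
  - by rewrite [X in _ < X]ger0_norm ?addr_ge0// ltrDl.
have GE p q x : G p q x = p * G 1 0 x + q * G 0 1 x.
  apply/cvg_lim => //.
  rewrite [pseries _ _](_ : _ = (fun n => p * pseries (L 1 0) x n) +
    (fun n => q * pseries (L 0 1) x n)).
    by apply: cvgD; apply: cvgMl_tmp; exact: cvgL.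
  apply/funext => n; rewrite /pseries /series /= !fctE !mulr_sumr -big_split /=.
  by apply: eq_bigr => k _; rewrite /L; ring.
pose C := G 1 0; pose S := G 0 1.
have dC (x : R) : is_derive x 1 C (a * C x - b * S x).
  have := dG 1 0 x; rewrite (GE (_ + _)).
  by rewrite !mul1r !mul0r addr0 sub0r mulNr.
have dS (x : R) : is_derive x 1 S (b * C x + a * S x).
  have := dG 0 1 x; rewrite (GE (_ + _)).
  by rewrite !mul1r !mul0r add0r subr0.
have C0 : C 0 = 1 by rewrite /C /G pseries_at0 /L expr0 /= factE; field.
have S0 : S 0 = 0 by rewrite /S /G pseries_at0 /L expr0 /= factE; field.
have [C1 S1] := linear_ode_expR dC dS C0 S0.
have LE p q : series (L p q) @ \oo --> G p q 1.
  rewrite [series _](_ : _ = pseries (L p q) 1); first exact: cvgL.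
  apply/funext => n; rewrite /pseries /series /=.
  by apply: eq_bigr => k _; rewrite expr1n mulr1.
split; rewrite /cexp /= -/a -/b.
  rewrite -C1 [series _](_ : _ = series (L 1 0)); first exact: LE.
  apply/funext => n; rewrite /series /=.
  by apply: eq_bigr => k _; rewrite /L mul1r mul0r addr0.
rewrite -S1 [series _](_ : _ = series (L 0 1)); first exact: LE.
apply/funext => n; rewrite /series /=.
by apply: eq_bigr => k _; rewrite /L mul1r mul0r add0r.
Qed.
(** Differentiating an exponential generating series, read backwards: from
    [v_(n+1) = (n+1) u_n] one gets [v_(n+1) / (n+1)! = u_n / n!].  It serves the
    nilpotent case below, where the coefficients are [n w^(n-1)]. *)
Lemma egf_sum_shift u v l : egf_sum u l -> v 0%N = 0 ->
  (forall n, v n.+1 = n.+1%:R * u n) -> egf_sum v l.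
Proof.
move=> [ur ui] v0 vS.
have fact_shift n (x : R) : n.+1`!%:R^-1 * (n.+1%:R * x) = n`!%:R^-1 * x.
  rewrite factS natrM invfM !mulrA [_ * _ * n.+1%:R]mulrAC.
  by rewrite mulVf ?mul1r ?pnatr_eq0.
have reN n z : re (n%:R * z) = n%:R * re z.
  by rewrite mulr_natl raddfMn /= mulr_natl.
have imN n z : im (n%:R * z) = n%:R * im z.
  by rewrite mulr_natl raddfMn /= mulr_natl.
split; rewrite -cvg_shiftS.
  rewrite (_ : [sequence _]_n = series (fun n => n`!%:R^-1 * re (u n)))//.
  apply/funext => n; rewrite /series /= big_nat_recl// v0 mulr0 add0r.
  by apply: eq_bigr => k _; rewrite vS reN fact_shift.
rewrite (_ : [sequence _]_n = series (fun n => n`!%:R^-1 * im (u n)))//.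
apply/funext => n; rewrite /series /= big_nat_recl// v0 mulr0 add0r.
by apply: eq_bigr => k _; rewrite vS imN fact_shift.
Qed.

End ComplexExponential.

(** * Star products on one sphere, and the star powers *)

Section QuaternionSlices.
Local Open Scope complex_scope.
Variable R : realType.
Local Notation H := (quat R).
Local Notation re := (@complex.Re R).
Local Notation im := (@complex.Im R).
Implicit Types (p q I J P Q : H) (f g h : H -> H) (a b c : R).

Lemma unit_sphereP I : unit_sphere I <->
  q_re I = 0 /\ q_i I ^+ 2 + q_j I ^+ 2 + q_k I ^+ 2 = 1.
Proof.
rewrite /unit_sphere /= (quatE I); move: (q_re I) (q_i I) (q_j I) (q_k I).
move=> a b c d; have [-> -> -> ->] := mkqK a b c d; rewrite mkqM mkq1.
rewrite -[X in _ = X]scaleN1r mkqZ; split=> [e|[-> e]]; last first.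
  by move: e; rewrite !expr2 => e; congr mkq; lra.
have [e0 e1 e2 e3] : [/\ a * a - b * b - c * c - d * d = -1 * 1,
  a * b + b * a + c * d - d * c = -1 * 0,
  a * c - b * d + c * a + d * b = -1 * 0 &
  a * d + b * c - c * b + d * a = -1 * 0].
  by split; [have := congr1 (@q_re R) e|have := congr1 (@q_i R) e|
    have := congr1 (@q_j R) e|have := congr1 (@q_k R) e];
    rewrite /q_re /q_i /q_j /q_k !mxE.
suff a0 : a = 0 by split=> //; rewrite a0 in e0; lra.
have [//|/eqP a0] := eqVneq a 0.
have b0 : b = 0 by apply: (mulfI (introN eqP a0)); lra.
have c0 : c = 0 by apply: (mulfI (introN eqP a0)); lra.
have d0 : d = 0 by apply: (mulfI (introN eqP a0)); lra.
by have := sqr_ge0 a; rewrite expr2 => ?; rewrite b0 c0 d0 in e0; lra.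
Qed.

Lemma unit_sphereN I : unit_sphere I -> unit_sphere (- I).
Proof. by rewrite /unit_sphere /= mulrNN. Qed.

Lemma unit_sphere_qi : unit_sphere (@qi R).
Proof.
apply/unit_sphereP; rewrite /qi; have [-> -> -> ->] := mkqK 0 1 0 (0 : R).
by split => //; ring.
Qed.

Lemma unit_sphere_conj p I : p != 0 -> unit_sphere I ->
  unit_sphere (p^-1 * I * p).
Proof.
move=> p0; rewrite /unit_sphere /= => II.
have pp : p * p^-1 = 1 by exact: mulrV.
rewrite !mulrA -[_ * p * p^-1]mulrA pp mulr1 -[_ * I * I]mulrA II mulrN1 mulNr.
by rewrite mulVr.
Qed.

(** The values of [f] on the sphere [a + b S]: the pair [(P, Q)], seen as the
    element [P + sqrt(-1) Q] of the complexified quaternions, determines [f] there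
    and is determined by it. *)
Definition slice_at f a b P Q :=
  forall I, unit_sphere I -> f (a%:A + b *: I) = P + I * Q.

(** The two opposite units [I] and [- I] already separate [P] and [Q]. *)
Lemma slice_value_inj P Q P' Q' :
  (forall I, unit_sphere I -> P + I * Q = P' + I * Q') -> P = P' /\ Q = Q'.
Proof.
move=> e; have := e _ unit_sphere_qi; have := e _ (unit_sphereN unit_sphere_qi).
rewrite !mulNr => e1 e2.
have dbl (x y : H) : (x - y) + (x + y) = x *+ 2.
  by rewrite addrACA addNr addr0 mulr2n.
have e3 : P *+ 2 = P' *+ 2.
  by rewrite -(dbl P (qi R * Q)) e1 e2 dbl.
have PP' : P = P'.
  have : (2%:R : R) *: P = (2%:R : R) *: P' by rewrite !scaler_nat.
  by apply: scalerI; rewrite pnatr_eq0.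
split=> //; move: e2; rewrite PP' => /addrI /(congr1 (fun x => qi R * x)).
by rewrite !mulrA unit_sphere_qi !mulN1r => /oppr_inj.
Qed.

(** On a sphere the star product is the product of complexified quaternions.
    For [p := P + I Q] nonzero, the twisted argument [p^-1 (a + b I) p] is the point
    of the same sphere with unit [p^-1 I p], and [p (P' + p^-1 I p Q')] is
    [p P' + I p Q']; for [p = 0] this last expression vanishes too. *)
Lemma slice_at_star f g a b P Q P' Q' :
  slice_at f a b P Q -> slice_at g a b P' Q' ->
  slice_at (star f g) a b (P * P' - Q * Q') (P * Q' + Q * P').
Proof.
move=> hf hg I SI; rewrite /star (hf I SI).
have rhsE : P * P' - Q * Q' + I * (P * Q' + Q * P') =
    (P + I * Q) * P' + I * (P + I * Q) * Q'.
  rewrite mulrDr !mulrA [I * (P + _)]mulrDr !mulrA SI mulN1r !mulrDl mulNr.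
  by rewrite [I * P * Q' + _]addrC addrACA [- _ + _]addrC.
have [p0|p0] := eqVneq (P + I * Q) 0.
  by rewrite rhsE p0 mulr0 !mul0r addr0.
rewrite rhsE; move: (P + I * Q) p0 => p p0 {rhsE}.
have pp : p * p^-1 = 1 by exact: mulrV.
have -> : p^-1 * (a%:A + b *: I) * p = a%:A + b *: (p^-1 * I * p).
  rewrite mulrDr mulrDl mulr_algr -[(a *: _) * p]scalerAl mulVr//.
  by rewrite -[p^-1 * (b *: I)]scalerAr -[(b *: _) * p]scalerAl.
rewrite (hg _ (unit_sphere_conj p0 SI)) mulrDr !mulrA pp mul1r.
by [].
Qed.

Lemma quat_mkq P : exists a b c d, P = mkq a b c d.
Proof. by exists (q_re P), (q_i P), (q_j P), (q_k P); exact: quatE. Qed.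

Lemma mkqN a b c d : - mkq a b c d = mkq (- a) (- b) (- c) (- d) :> H.
Proof. by rewrite -scaleN1r mkqZ !mulN1r. Qed.

Lemma qvec_mkq a b c d : qvec (mkq a b c d) = mkq 0 b c d :> H.
Proof.
rewrite /qvec; have [-> _ _ _] := mkqK a b c d.
by rewrite mkq1 mkqZ mkqN mkqD; congr mkq; ring.
Qed.

(** A complexified quaternion [P + sqrt(-1) Q] is [w + v] with [w] a complex
    scalar, [scalar_part P Q], and [v] a complex vector, for which [v * v = - s]
    where [s], a complex number, is [vector_square P Q]. *)
Definition scalar_part P Q : R[i] := q_re P +i* q_re Q.

Definition vector_square P Q : R[i] :=
  (q_i P +i* q_i Q) ^+ 2 + (q_j P +i* q_j Q) ^+ 2 + (q_k P +i* q_k Q) ^+ 2.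

Lemma vector_squareE P Q : vector_square P Q =
  (q_i P ^+ 2 + q_j P ^+ 2 + q_k P ^+ 2
   - (q_i Q ^+ 2 + q_j Q ^+ 2 + q_k Q ^+ 2)) +i*
  (2 * (q_i P * q_i Q + q_j P * q_j Q + q_k P * q_k Q)).
Proof.
rewrite /vector_square !expr2; apply/eqP; rewrite eq_complex /=.
by apply/andP; split; apply/eqP; ring.
Qed.

(** The coefficients of [(w + v) ^+ n = A + B v] when [v * v = - s]. *)
Fixpoint pow_coef (w s : R[i]) (n : nat) : R[i] * R[i] :=
  if n is m.+1 then
    (w * (pow_coef w s m).1 - s * (pow_coef w s m).2,
     (pow_coef w s m).1 + w * (pow_coef w s m).2)
  else (1, 0).

(** The two components of the complexified quaternion [A + B v], for complex
    [A], [B] and for [v] the vector part of [P + sqrt(-1) Q]. *)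
Definition affine_even (A B : R[i]) P Q : H :=
  (re A)%:A + re B *: qvec P - im B *: qvec Q.

Definition affine_odd (A B : R[i]) P Q : H :=
  (im A)%:A + re B *: qvec Q + im B *: qvec P.

Lemma affine_stem_mul (A B : R[i]) P Q
    (w := scalar_part P Q) (s := vector_square P Q) :
  P * affine_even A B P Q - Q * affine_odd A B P Q =
    affine_even (w * A - s * B) (A + w * B) P Q /\
  P * affine_odd A B P Q + Q * affine_even A B P Q =
    affine_odd (w * A - s * B) (A + w * B) P Q.
Proof.
have affine_even_mkq C D (p0 p1 p2 p3 q0 q1 q2 q3 : R) :
    affine_even C D (mkq p0 p1 p2 p3) (mkq q0 q1 q2 q3) =
    mkq (re C) (re D * p1 - im D * q1) (re D * p2 - im D * q2)
      (re D * p3 - im D * q3).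
  rewrite /affine_even !qvec_mkq mkq1 !mkqZ !mkqN !mkqD.
  by congr mkq; ring.
have affine_odd_mkq C D (p0 p1 p2 p3 q0 q1 q2 q3 : R) :
    affine_odd C D (mkq p0 p1 p2 p3) (mkq q0 q1 q2 q3) =
    mkq (im C) (re D * q1 + im D * p1) (re D * q2 + im D * p2)
      (re D * q3 + im D * p3).
  rewrite /affine_odd !qvec_mkq mkq1 !mkqZ !mkqD.
  by congr mkq; ring.
rewrite /w /s vector_squareE /scalar_part.
have [p0 [p1 [p2 [p3 ->]]]] := quat_mkq P.
have [q0 [q1 [q2 [q3 ->]]]] := quat_mkq Q.
have [-> -> -> ->] := mkqK p0 p1 p2 p3; have [-> -> -> ->] := mkqK q0 q1 q2 q3.
rewrite !affine_even_mkq !affine_odd_mkq !mkqM mkqN !mkqD.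
case: A B => [a1 a2] [b1 b2] /=.
by split; congr mkq; ring.
Qed.

Lemma slice_at_star_pow h a b P Q n
    (c := pow_coef (scalar_part P Q) (vector_square P Q) n) :
  slice_at h a b P Q ->
  slice_at (star_pow h n) a b
    (affine_even c.1 c.2 P Q) (affine_odd c.1 c.2 P Q).
Proof.
rewrite /c => hP; elim: n {c} => [|n IHn] /=.
  move=> I SI; rewrite /star_pow /affine_even /affine_odd /= !scale0r scale1r.
  by rewrite !addr0 subr0 mulr0 addr0.
have := slice_at_star hP IHn.
by rewrite (affine_stem_mul _ _ P Q).1 (affine_stem_mul _ _ P Q).2.
Qed.

(** The exponential of [w + v] is [A + B v] with [A +/- B t = e^(w +/- t)] for
    [t] a square root of [- s].  If [t] is not zero, [B = 0] says
    [e^(2 t) = 1], that is [t = k pi sqrt(-1)] with [k] nonzero, so that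
    [s = (k pi)^2].  If [t = 0], then [B = e^w] does not vanish. *)
Lemma egf_sum_pow_coef (w s t : R[i]) : t ^+ 2 = - s ->
  exists A B, [/\ egf_sum (fun n => (pow_coef w s n).1) A,
    egf_sum (fun n => (pow_coef w s n).2) B,
    s = 0 -> A = cexp w &
    B = 0 -> exists m : int,
      [/\ m != 0, s = ((m%:~R * pi) ^+ 2)%:C & A = (-1) ^ m * cexp w]].
Proof.
move=> ts.
have coefD n : (pow_coef w s n).1 + t * (pow_coef w s n).2 = (w + t) ^+ n.
  elim: n => [|n IHn]; first by rewrite /= mulr0 addr0 expr0.
  rewrite exprS -IHn /=; have -> : s = - t ^+ 2 by rewrite ts opprK.
  by ring.
have coefB n : (pow_coef w s n).1 - t * (pow_coef w s n).2 = (w - t) ^+ n.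
  elim: n => [|n IHn]; first by rewrite /= mulr0 subr0 expr0.
  rewrite exprS -IHn /=; have -> : s = - t ^+ 2 by rewrite ts opprK.
  by ring.
have [t0|t0] := eqVneq t 0.
  have s0 : s = 0 by rewrite -[s]opprK -ts t0 expr0n oppr0.
  have c1 n : (pow_coef w s n).1 = w ^+ n.
    by have := coefD n; rewrite t0 mul0r !addr0.
  exists (cexp w), (cexp w); split => //.
  - by apply: (eq_egf_sum c1); exact: egf_sum_cexp.
  - apply: (egf_sum_shift (egf_sum_cexp w)) => // n.
    elim: n => [|n IHn]; first by rewrite /= mulr0 addr0 mul1r expr0.
    have -> : (pow_coef w s n.+2).2 =
      (pow_coef w s n.+1).1 + w * (pow_coef w s n.+1).2 by [].
    by rewrite IHn c1 exprS -[n.+2%:R]natr1; ring.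
  - by move=> /eqP; rewrite (negbTE (cexp_neq0 w)).
have two0 : 2%:R != 0 :> R[i] by rewrite pnatr_eq0.
have AE n : (pow_coef w s n).1 = 2^-1 * ((w + t) ^+ n + (w - t) ^+ n).
  by rewrite -coefD -coefB; field.
have BE n : (pow_coef w s n).2 =
    (2 * t)^-1 * ((w + t) ^+ n + -1 * (w - t) ^+ n).
  by rewrite -coefD -coefB; field.
exists (2^-1 * (cexp (w + t) + cexp (w - t))),
  ((2 * t)^-1 * (cexp (w + t) + -1 * cexp (w - t))); split.
- apply: (eq_egf_sum AE).
  by apply: egf_sumM; apply: egf_sumD; exact: egf_sum_cexp.
- apply: (eq_egf_sum BE).
  by apply: egf_sumM; apply: egf_sumD; [|apply: egf_sumM]; exact: egf_sum_cexp.
- by move=> s0; move/eqP: ts; rewrite s0 oppr0 sqrf_eq0 (negbTE t0).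
move=> /eqP; rewrite mulf_eq0 invr_eq0 mulf_eq0 (negbTE two0) (negbTE t0) /=.
rewrite mulN1r subr_eq0 => /eqP e.
have : cexp (2 * t) = 1.
  apply: (mulfI (cexp_neq0 (w - t))); rewrite -cexpD mulr1 -e.
  by congr cexp; ring.
move=> /cexp_eq1 [k k2].
have tE : t = 0 +i* (k%:~R * pi).
  apply: (mulfI two0); rewrite k2 intrM; apply/eqP; rewrite eq_complex /=.
  by apply/andP; split; apply/eqP; ring.
exists k; split.
- by apply: contraNneq t0 => k0; rewrite tE k0 mul0r.
- rewrite -[s]opprK -ts tE; apply/eqP; rewrite eq_complex !expr2 /=.
  by apply/andP; split; apply/eqP; ring.
- by rewrite -e cexpD tE cexp_pi; field.
Qed.

End QuaternionSlices.

(** * The star exponential on one sphere *)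

Section StarExponential.
Local Open Scope complex_scope.
Variable R : realType.
Local Notation H := (quat R).
Local Notation re := (@complex.Re R).
Local Notation im := (@complex.Im R).
Implicit Types (p q I J P Q : H) (f g h : H -> H) (a b c : R).

(** For fixed [I] the terms of the star exponential are real combinations of
    the four quaternions [1], [I], [V + I U] and [I V - U], where [V] and [U]
    are the vector parts of [P] and [Q]; so the series is summed coefficientwise. *)
Lemma slice_at_star_exp h a b P Q
    (c := pow_coef (scalar_part P Q) (vector_square P Q)) A B :
  egf_sum (fun n => (c n).1) A -> egf_sum (fun n => (c n).2) B ->
  slice_at h a b P Q ->
  slice_at (star_exp h) a b (affine_even A B P Q) (affine_odd A B P Q).
Proof.
move=> [Are Aim] [Bre Bim] hP I SI.
have affineE (C D : R[i]) : affine_even C D P Q + I * affine_odd C D P Q =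
    re C *: 1 + im C *: I + re D *: (qvec P + I * qvec Q)
    + im D *: (I * qvec P - qvec Q).
  rewrite /affine_even /affine_odd; move: (qvec P) (qvec Q) => V U.
  rewrite !mulrDr mulr_algr -!scalerAr !scalerDr scalerN.
  have swap (x y z u v t : H) :
      x + y - z + (u + v + t) = x + u + (y + v) + (t - z).
    rewrite -!addrA; congr (_ + _).
    by rewrite [- z + _]addrC -!addrA [LHS]addrCA.
  exact: swap.
rewrite /star_exp affineE; apply/cvg_lim => //.
rewrite (_ : series _ = (fun n =>
  series (fun n => n`!%:R^-1 * re (c n).1) n *: 1 +
  series (fun n => n`!%:R^-1 * im (c n).1) n *: I +
  series (fun n => n`!%:R^-1 * re (c n).2) n *: (qvec P + I * qvec Q) +
  series (fun n => n`!%:R^-1 * im (c n).2) n *: (I * qvec P - qvec Q))).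
  by apply: cvgD; [apply: cvgD; [apply: cvgD|]|]; apply: cvgZr_tmp.
apply/funext => n; rewrite /series /= !scaler_suml -!big_split /=.
apply: eq_bigr => k _.
by rewrite (slice_at_star_pow k hP SI) affineE !scalerDr !scalerA.
Qed.

(** Testing on [i] and [- i] leaves only the coordinates of [1] and [i] in [P]
    and [Q], and testing on [j] removes the coordinate of [i]. *)
Lemma slice_value_preserving P Q :
  (forall I, unit_sphere I -> slice_plane I (P + I * Q)) ->
  qvec P = 0 /\ qvec Q = 0.
Proof.
have [p0 [p1 [p2 [p3 ->]]]] := quat_mkq P.
have [q0 [q1 [q2 [q3 ->]]]] := quat_mkq Q => e.
have uj : unit_sphere (@qj R).
  apply/unit_sphereP; rewrite /qj; have [-> -> -> ->] := mkqK 0 0 1 (0 : R).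
  by split => //; ring.
have [x [y]] := e _ (unit_sphere_qi R).
have [x' [y']] := e _ (unit_sphereN (unit_sphere_qi R)).
have [x2 [y2]] := e _ uj.
rewrite /qi /qj mkq1 !mkqN !mkqM !mkqZ !mkqD => e1 e2 e3.
have [] := (congr1 (@q_i R) e1, congr1 (@q_k R) e1).
have [] := (congr1 (@q_j R) e2, congr1 (@q_k R) e2).
have [] := (congr1 (@q_j R) e3, congr1 (@q_k R) e3).
rewrite /q_i /q_j /q_k !mxE /= => {e1 e2 e3} e1 e2 e3 e4 e5 e6.
by rewrite !qvec_mkq mkq0; split; congr mkq; lra.
Qed.

(** If the star exponential [A + B v] takes the sphere into the slice planes,
    then [B v = 0].  Either [B = 0], and [egf_sum_pow_coef] gives a nonzero [m], or
    [v = 0], and [m = 0] does. *)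
Lemma star_exp_slice_preserving h a b P Q : slice_at h a b P Q ->
  (forall I, unit_sphere I -> slice_plane I (star_exp h (a%:A + b *: I))) ->
  exists m : int, let E := (-1) ^ m * cexp (scalar_part P Q) in
    [/\ vector_square P Q = ((m%:~R * pi) ^+ 2)%:C,
        m = 0 -> qvec P = 0 /\ qvec Q = 0 &
        slice_at (star_exp h) a b (re E)%:A (im E)%:A].
Proof.
move=> hP hpres.
have [A [B [sA sB A0 B0]]] :=
  egf_sum_pow_coef (scalar_part P Q) (sqrtCK (- vector_square P Q)).
have hexp := slice_at_star_exp sA sB hP.
have [|] := @slice_value_preserving (affine_even A B P Q) (affine_odd A B P Q).
  by move=> I SI; rewrite -(hexp I SI); exact: hpres.
have qvecD (x : R) (y : H) : qvec (x%:A + y) = qvec y.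
  have [y0 [y1 [y2 [y3 ->]]]] := quat_mkq y.
  by rewrite mkq1 mkqZ mkqD !qvec_mkq; congr mkq; ring.
have qvec_lin (x y : R) (p q : H) :
    qvec (x *: qvec p + y *: qvec q) = x *: qvec p + y *: qvec q.
  have [y0 [y1 [y2 [y3 ->]]]] := quat_mkq p.
  have [z0 [z1 [z2 [z3 ->]]]] := quat_mkq q.
  by rewrite !qvec_mkq !mkqZ !mkqD !qvec_mkq; congr mkq; ring.
rewrite /affine_even /affine_odd -!addrA -scaleNr !qvecD !qvec_lin => e0 e1.
have [B_0|/eqP B_0] := eqVneq B 0.
  have [m [m0 sE AE]] := B0 B_0; exists m; rewrite /= -AE; split => //.
    by move/eqP: m0.
  by move: hexp; rewrite /affine_even /affine_odd B_0 /= !scale0r !addr0 subr0.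
have [V0 U0] : qvec P = 0 /\ qvec Q = 0.
  (* multiply [B v = 0] by the conjugate of [B] *)
  have nB : re B ^+ 2 + im B ^+ 2 != 0.
    apply: contra_notN B_0; rewrite paddr_eq0 ?sqr_ge0// !sqrf_eq0.
    by case: (B) => x y /= /andP[/eqP -> /eqP ->].
  split; apply: (scalerI nB); rewrite scaler0.
    transitivity (re B *: (re B *: qvec P + - im B *: qvec Q) +
        im B *: (re B *: qvec Q + im B *: qvec P)).
      have [v0 [v1 [v2 [v3 ->]]]] := quat_mkq (qvec P).
      have [u0 [u1 [u2 [u3 ->]]]] := quat_mkq (qvec Q).
      by rewrite !mkqZ !mkqD !mkqZ !mkqD; congr mkq; ring.
    by rewrite e0 e1 !scaler0 addr0.
  transitivity (re B *: (re B *: qvec Q + im B *: qvec P) -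
      im B *: (re B *: qvec P + - im B *: qvec Q)).
    have [v0 [v1 [v2 [v3 ->]]]] := quat_mkq (qvec P).
    have [u0 [u1 [u2 [u3 ->]]]] := quat_mkq (qvec Q).
    by rewrite !mkqZ !mkqD !mkqZ mkqN !mkqD; congr mkq; ring.
  by rewrite e0 e1 !scaler0 subr0.
have s0 : vector_square P Q = 0.
  rewrite vector_squareE.
  have [p0 [p1 [p2 [p3 EP]]]] := quat_mkq P.
  have [q0 [q1 [q2 [q3 EQ]]]] := quat_mkq Q.
  have zero x0 x1 x2 x3 : qvec (mkq x0 x1 x2 x3) = 0 :> H ->
      [/\ x1 = 0, x2 = 0 & x3 = 0].
    rewrite qvec_mkq mkq0 => e.
    have := (congr1 (@q_i R) e, congr1 (@q_j R) e, congr1 (@q_k R) e).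
    by rewrite /q_i /q_j /q_k !mxE => -[[]].
  move: V0 U0; rewrite EP EQ => /zero[-> -> ->] /zero[-> -> ->].
  have [_ -> -> ->] := mkqK p0 0 0 0; have [_ -> -> ->] := mkqK q0 0 0 0.
  by rewrite !(expr0n, mulr0, addr0, subr0).
exists 0; rewrite expr0z mul1r s0 mul0r expr0n; split => //=.
move: hexp; rewrite /affine_even /affine_odd V0 U0 !scaler0 subr0 !addr0.
by rewrite A0.
Qed.

End StarExponential.

(** * Circular domains and stem functions *)

Section SliceGeometry.
Variable R : realType.
Local Notation H := (quat R).
Implicit Types (p q I J P Q : H) (f g h : H -> H) (a b c : R).
Implicit Types (Omega : set H) (F : R * R -> H).

Lemma slice_coords I a b : unit_sphere I ->
  [/\ q_re (a%:A + b *: I) = a, qvec (a%:A + b *: I) = b *: I &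
      qnorm (b *: I) = `|b|].
Proof.
move=> /unit_sphereP; have [x [y [z [t ->]]]] := quat_mkq I.
have [-> -> -> ->] := mkqK x y z t => -[-> n1].
rewrite mkq1 !mkqZ mkqD qvec_mkq /qnorm qsqnE; split.
- have [-> _ _ _] := mkqK (a * 1 + b * 0) (a * 0 + b * y) (a * 0 + b * z)
    (a * 0 + b * t).
  by ring.
- by congr mkq; ring.
- rewrite -[in RHS](sqrtr_sqr b); congr Num.sqrt.
  by rewrite !exprMn expr0n mulr0 add0r -!mulrDr n1 mulr1.
Qed.

Lemma slice_decomp q : exists2 I, unit_sphere I &
  q = (q_re q)%:A + qnorm (qvec q) *: I.
Proof.
have qE : q = (q_re q)%:A + qvec q by rewrite /qvec addrC subrK.
have [n0|n0] := eqVneq (qnorm (qvec q)) 0.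
  exists (qi R); first exact: unit_sphere_qi.
  have v0 : qsqn (qvec q) <= 0 by rewrite -sqrtr_eq0; exact/eqP.
  have : qsqn (qvec q) == 0.
    by rewrite eq_le v0 /qsqn !addr_ge0 ?sqr_ge0.
  by rewrite qsqn_eq0 => /eqP v00; rewrite n0 scale0r [LHS]qE v00 !addr0.
exists (calJ q); last by rewrite /calJ scalerA divff// scale1r.
apply/unit_sphereP; rewrite /calJ.
have : qnorm (qvec q) ^+ 2 = qsqn (qvec q).
  by rewrite sqr_sqrtr// /qsqn !addr_ge0 ?sqr_ge0.
move: (qnorm (qvec q)) n0 => r r0 {qE}; have [x [y [z [t ->]]]] := quat_mkq q.
rewrite qvec_mkq qsqnE mkqZ.
have [-> -> -> ->] := mkqK (r^-1 * 0) (r^-1 * y) (r^-1 * z) (r^-1 * t).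
rewrite mulr0 expr0n add0r !exprMn -!mulrDr => <-; split=> //.
by rewrite -exprMn mulVf// expr1n.
Qed.

Lemma circular_slice Omega I J a b : circular Omega ->
  unit_sphere I -> unit_sphere J -> Omega (a%:A + b *: I) ->
  Omega (a%:A + b *: J).
Proof.
move=> circ SI SJ /circ; apply; rewrite /sphere_of.
have [-> -> ->] := slice_coords a b SI.
have [b0|b0] := leP 0 b.
  by exists J => //; rewrite ger0_norm.
exists (- J); first exact: unit_sphereN.
by rewrite ltr0_norm// scaleNr scalerN opprK.
Qed.

Lemma stem_domainP Omega I a b : circular Omega -> unit_sphere I ->
  stem_domain Omega (a, b) <-> Omega (a%:A + b *: I).
Proof.
move=> circ SI; split=> [[J SJ /= HJ]|HI]; last by exists I.
exact: circular_slice circ SJ SI HJ.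
Qed.

Lemma stem_domain_abs Omega q : circular Omega -> Omega q ->
  stem_domain Omega (q_re q, qnorm (qvec q)).
Proof.
move=> circ; have [I SI {1}->] := slice_decomp q => Oq.
by exists I.
Qed.

Lemma open_stem_domain Omega : circular Omega -> open Omega ->
  open (stem_domain Omega).
Proof.
move=> circ oO.
have -> : stem_domain Omega =
    (fun z : R * R => z.1%:A + z.2 *: qi R) @^-1` Omega.
  apply/seteqP; split => -[a b] /=;
    by apply stem_domainP => //; exact: unit_sphere_qi.
apply: open_comp => // z _.
by apply: cvgD; apply: cvgZr_tmp; [exact: cvg_fst|exact: cvg_snd].
Qed.

Lemma open_stem_domain_box Omega (z : R * R) : circular Omega -> open Omega ->
  stem_domain Omega z -> exists2 e : R, 0 < e & forall a b,
    `|a - z.1| < e -> `|b - z.2| < e -> stem_domain Omega (a, b).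
Proof.
move=> circ oO Dz.
have : nbhs z (stem_domain Omega).
  by apply: open_nbhs_nbhs; split => //; exact: open_stem_domain.
move=> /nbhs_ballP [e /= e0 ze]; exists e => // a b az bz.
by apply: ze; split => /=; rewrite /ball /= distrC.
Qed.

Lemma induced_slice_at Omega F0 F1 f a b : circular Omega ->
  Defs.induced Omega F0 F1 f -> stem_domain Omega (a, b) ->
  slice_at f a b (F0 (a, b)) (F1 (a, b)).
Proof.
by move=> circ ind Dab I SI; apply: ind => //; apply/stem_domainP.
Qed.

(** The slice function of a stem function.  At real points [calJ] is 0, which
    agrees with the vanishing of odd stem components there. *)
Definition induce F0 F1 : H -> H := fun q =>
  F0 (q_re q, qnorm (qvec q)) + calJ q * F1 (q_re q, qnorm (qvec q)).

Lemma quat_eq_oppr p : p = - p -> p = 0.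
Proof.
move=> e; have : (2 : R) *: p = 0 by rewrite scaler_nat mulr2n {1}e addNr.
by move=> /eqP; rewrite scaler_eq0 pnatr_eq0 => /eqP.
Qed.

Lemma induced_induce Omega F0 F1 :
  (forall z, stem_domain Omega z ->
    F0 (z.1, - z.2) = F0 z /\ F1 (z.1, - z.2) = - F1 z) ->
  Defs.induced Omega F0 F1 (induce F0 F1).
Proof.
move=> par I a b SI Oq; rewrite /induce /calJ.
have [-> -> ->] := slice_coords a b SI.
have [/= p0 p1] : _ /\ _ := par (a, b) (ex_intro2 _ _ I SI Oq).
have [b0|b0|b0] := ltgtP b 0.
- rewrite ltr0_norm// p0 p1 scalerA invrN mulNr mulVf ?lt_eqF//.
  by rewrite scaleN1r mulrNN.
- by rewrite gtr0_norm// scalerA mulVf ?gt_eqF// scale1r.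
- rewrite b0 in p1 *; rewrite oppr0 in p1.
  by rewrite normr0 !scale0r scaler0 mul0r (quat_eq_oppr p1) mulr0.
Qed.

(** A continuous linear map commutes with the limit of difference quotients. *)
Lemma is_derive_linear (W : normedModType R) (L : {linear H -> W}) F z v :
  continuous L -> derivable F z v ->
  is_derive z v (L \o F) (L ('D_v F z)).
Proof.
move=> cL dF.
have cvgL : (fun t => t^-1 *: ((L \o F \o shift z) (t *: v) - (L \o F) z)) @ 0^'
    --> L ('D_v F z).
  rewrite (_ : (fun t => _) =
    L \o (fun t => t^-1 *: ((F \o shift z) (t *: v) - F z))).
    by apply: continuous_cvg; [exact: cL|exact: dF].
  by apply/funext => t /=; rewrite linearZ_LR /= [in RHS]raddfB.
by apply: DeriveDef; [exact: cvgP cvgL|exact: cvg_lim cvgL].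
Qed.

(** Continuous real linear maps of the quaternions act on values, whereas the
    conditions defining stem functions act on variables; openness of the domain
    carries the continuity of the partial derivatives over. *)
Lemma stem_linear (D : set (R * R)) F0 F1 (L : {linear H -> H}) :
  open D -> continuous L -> stem D F0 F1 -> stem D (L \o F0) (L \o F1).
Proof.
move=> oD cL [C0 C1 CR].
have dL F v z : D z -> derivable F z v -> 'D_v (L \o F) z = L ('D_v F z).
  by move=> Dz dF; case: (is_derive_linear cL dF).
have contL (G G' : R * R -> H) (z : R * R) :
    D z -> (forall y, D y -> G' y = L (G y)) ->
    {for z, continuous G} -> {for z, continuous G'}.
  move=> Dz G'E cG; rewrite /prop_for /continuous_at (G'E z Dz).
  have cLG : L (G y) @[y --> z] --> L (G z).
    by apply: continuous_cvg; [exact: cL|].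
  apply: cvg_trans cLG; apply: near_eq_cvg.
  have : nbhs z D by exact: open_nbhs_nbhs.
  by apply: filterS => y Dy; rewrite G'E.
have C1L F : C1_on D F -> C1_on D (L \o F).
  move=> CF z Dz; have [da db ca cb] := CF z Dz; split.
  - by case: (is_derive_linear cL da).
  - by case: (is_derive_linear cL db).
  - apply: (contL (d_alpha F) (d_alpha (L \o F)) z Dz) => // y Dy.
    by have [? _ _ _] := CF y Dy; exact: (dL F _ y Dy).
  - apply: (contL (d_beta F) (d_beta (L \o F)) z Dz) => // y Dy.
    by have [_ ? _ _] := CF y Dy; exact: (dL F _ y Dy).
split; [exact: C1L|exact: C1L|] => z Dz; have [e0 e1 cr0 cr1] := CR z Dz.
have [a0 b0 _ _] := C0 z Dz; have [a1 b1 _ _] := C1 z Dz; split => /=.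
- by rewrite e0.
- by rewrite e1 linearN.
- have ea : d_alpha (L \o F0) z = L (d_alpha F0 z) := dL F0 _ z Dz a0.
  have eb : d_beta (L \o F1) z = L (d_beta F1 z) := dL F1 _ z Dz b1.
  by rewrite ea eb cr0.
- have ea : d_alpha (L \o F1) z = L (d_alpha F1 z) := dL F1 _ z Dz a1.
  have eb : d_beta (L \o F0) z = L (d_beta F0 z) := dL F0 _ z Dz b0.
  by rewrite ea eb cr1 linearN.
Qed.

End SliceGeometry.

(** * Real part, vector part and symmetrization in terms of the stem function *)

Section SliceDecomposition.
Local Open Scope complex_scope.
Variable R : realType.
Local Notation H := (quat R).
Local Notation re := (@complex.Re R).
Local Notation im := (@complex.Im R).
Implicit Types (p q I J P Q : H) (f g h : H -> H) (a b c : R).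
Implicit Types (Omega : set H) (F : R * R -> H).

Definition qcoord (l : 'I_4) (q : H) : R^o := q 0 l.

Lemma qcoord_linear l : linear (qcoord l).
Proof. by move=> k p q; rewrite /qcoord !mxE. Qed.

HB.instance Definition _ l := GRing.isLinear.Build R H R^o *:%R (qcoord l)
  (qcoord_linear l).

Lemma continuous_qcoord l : continuous (qcoord l).
Proof. by move=> q; exact: coord_continuous. Qed.

(** Taking a real coordinate as a map of the quaternions to themselves makes
    [stem_linear] applicable to the four slice preserving components. *)
Definition qpart (l : 'I_4) (q : H) : H := (qcoord l q)%:A.

Lemma qpart_linear l : linear (qpart l).
Proof. by move=> k p q; rewrite /qpart linearP scalerDl scalerA. Qed.

HB.instance Definition _ l := GRing.isLinear.Build R H H *:%R (qpart l)
  (qpart_linear l).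

Lemma continuous_qpart l : continuous (qpart l).
Proof.
move=> q.
by apply: cvgZr_tmp; [exact: nbhs_filter|exact: continuous_qcoord].
Qed.

Lemma qvec_linear : linear (@qvec R).
Proof.
move=> k p q; have [p0 [p1 [p2 [p3 ->]]]] := quat_mkq p.
have [q0 [q1 [q2 [q3 ->]]]] := quat_mkq q.
by rewrite mkqZ mkqD !qvec_mkq mkqZ mkqD; congr mkq; ring.
Qed.

HB.instance Definition _ := GRing.isLinear.Build R H H *:%R (@qvec R)
  qvec_linear.

Lemma continuous_qvec : continuous (@qvec R).
Proof.
move=> q; apply: (@cvgB _ H _ (nbhs q) (nbhs_filter q) id (qpart 0)).
  exact: cvg_id.
exact: continuous_qpart.
Qed.

Lemma qpart_sum q :
  q = qpart 0 q + qpart 1 q * qi R + qpart 2 q * qj R + qpart 3 q * qk R.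
Proof.
rewrite /qpart !mulr_algl /qi /qj /qk mkq1 !mkqZ !mkqD [LHS]quatE.
by rewrite /qcoord /q_re /q_i /q_j /q_k; congr mkq; ring.
Qed.

Lemma slice_value_sum I x0 x1 x2 x3 y0 y1 y2 y3 :
  (x0 + x1 * qi R + x2 * qj R + x3 * qk R) +
    I * (y0 + y1 * qi R + y2 * qj R + y3 * qk R) =
  (x0 + I * y0) + (x1 + I * y1) * qi R + (x2 + I * y2) * qj R +
    (x3 + I * y3) * qk R.
Proof.
rewrite !mulrDr !mulrDl !mulrA addrACA; congr (_ + _).
by rewrite addrACA; congr (_ + _); exact: addrACA.
Qed.

Section StemFunction.
Variables (Omega : set H) (h : H -> H) (F0 F1 : R * R -> H).
Hypotheses (circ : circular Omega) (oO : open Omega).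
Hypotheses (hstem : stem (stem_domain Omega) F0 F1)
  (hind : Defs.induced Omega F0 F1 h).

Let oD : open (stem_domain Omega).
Proof. exact: open_stem_domain. Qed.

Lemma stem_parity G0 G1 : stem (stem_domain Omega) G0 G1 ->
  forall z, stem_domain Omega z ->
    G0 (z.1, - z.2) = G0 z /\ G1 (z.1, - z.2) = - G1 z.
Proof. by move=> [_ _ e] z /e[]. Qed.

Lemma slice_preserving_of_real f G0 G1 : stem (stem_domain Omega) G0 G1 ->
  Defs.induced Omega G0 G1 f ->
  (forall z, stem_domain Omega z -> qvec (G0 z) = 0 /\ qvec (G1 z) = 0) ->
  slice_preserving Omega f.
Proof.
move=> sG iG vG; split; first by exists G0, G1.
move=> I SI _ [q [Oq [a [b qE]]] <-]; rewrite qE in Oq *.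
have [] := vG (a, b) (ex_intro2 _ _ I SI Oq).
rewrite /qvec (iG I a b SI Oq) => /subr0_eq -> /subr0_eq ->.
exists (q_re (G0 (a, b))), (q_re (G1 (a, b))).
by rewrite mulr_algr.
Qed.

Lemma slice_preserving_real f G0 G1 a b : slice_preserving Omega f ->
  Defs.induced Omega G0 G1 f -> stem_domain Omega (a, b) ->
  qvec (G0 (a, b)) = 0 /\ qvec (G1 (a, b)) = 0.
Proof.
move=> [_ pf] iG Dab; apply: slice_value_preserving => I SI.
have Oq : Omega (a%:A + b *: I) by apply/stem_domainP.
rewrite -(iG I a b SI Oq); apply: (pf I SI).
by exists (a%:A + b *: I) => //; split => //; exists a, b.
Qed.

Lemma real_part_exists :
  is_real_part Omega h (induce (qpart 0 \o F0) (qpart 0 \o F1)).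
Proof.
pose f l := induce (qpart l \o F0) (qpart l \o F1).
have sf l : stem (stem_domain Omega) (qpart l \o F0) (qpart l \o F1).
  exact: (stem_linear oD (@continuous_qpart l) hstem).
have fi l := induced_induce (stem_parity (sf l)).
have pf l : slice_preserving Omega (f l).
  apply: (slice_preserving_of_real (sf l) (fi l)) => z Dz.
  have qvec_real (x : R) : qvec x%:A = 0 :> H.
    by rewrite mkq1 mkqZ qvec_mkq mkq0; congr mkq; ring.
  by rewrite /= /qpart !qvec_real.
exists (f 1), (f 2), (f 3).
split; [exact: (pf 0)|exact: pf|exact: pf|exact: pf|] => q.
rewrite inE; have [I SI ->] := slice_decomp q.
move: (q_re q) (qnorm _) => a b Oq.
rewrite (hind SI Oq) /f !(fi _ I a b SI Oq) /=.
rewrite {1}(qpart_sum (F0 (a, b))) {1}(qpart_sum (F1 (a, b))).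
exact: slice_value_sum.
Qed.

(** Any decomposition [f_0 + f_1 i + f_2 j + f_3 k] into slice preserving
    functions is read off the coordinates of the stem function, because slice
    preserving functions have real stem components.  So every choice of real part
    takes these values. *)
Lemma slice_at_real_part a b : stem_domain Omega (a, b) ->
  slice_at (real_part Omega h) a b (q_re (F0 (a, b)))%:A (q_re (F1 (a, b)))%:A.
Proof.
move=> Dab.
have : is_real_part Omega h (real_part Omega h).
  by have := xgetPex (fun=> 0) (ex_intro _ _ real_part_exists).
move=> [f1 [f2 [f3 [p0 p1 p2 p3 hE]]]].
have val f : slice_preserving Omega f ->
    exists x y : R, slice_at f a b x%:A y%:A.
  move=> pf; have [[G0 [G1 [sG iG]]] _] := pf.
  have [] := slice_preserving_real pf iG Dab.
  move=> /subr0_eq e0 /subr0_eq e1.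
  exists (q_re (G0 (a, b))), (q_re (G1 (a, b))).
  by rewrite -e0 -e1; exact: induced_slice_at iG Dab.
have [x0 [y0 s0]] := val _ p0; have [x1 [y1 s1]] := val _ p1.
have [x2 [y2 s2]] := val _ p2; have [x3 [y3 s3]] := val _ p3.
have hat := induced_slice_at circ hind Dab.
have [] : F0 (a, b) = mkq x0 x1 x2 x3 /\ F1 (a, b) = mkq y0 y1 y2 y3.
  apply: slice_value_inj => I SI; rewrite -(hat I SI) hE; last first.
    by rewrite inE; apply/stem_domainP.
  rewrite (s0 I SI) (s1 I SI) (s2 I SI) (s3 I SI).
  have mkq_sum (x y z t : R) : mkq x y z t =
     x%:A + y%:A * qi R + z%:A * qj R + t%:A * qk R.
    by rewrite !mulr_algl /qi /qj /qk mkq1 !mkqZ !mkqD; congr mkq; ring.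
  rewrite (mkq_sum x0) (mkq_sum y0).
  exact: (esym (slice_value_sum I _ _ _ _ _ _ _ _)).
move=> -> ->; have [-> _ _ _] := mkqK x0 x1 x2 x3.
by have [-> _ _ _] := mkqK y0 y1 y2 y3.
Qed.

Lemma slice_at_vector_part a b : stem_domain Omega (a, b) ->
  slice_at (vector_part Omega h) a b (qvec (F0 (a, b))) (qvec (F1 (a, b))).
Proof.
move=> Dab I SI; rewrite /vector_part (slice_at_real_part Dab SI).
rewrite (induced_slice_at circ hind Dab SI) /qvec mulrBr.
by rewrite opprD addrACA.
Qed.

Lemma slice_at_vector_conj a b : stem_domain Omega (a, b) ->
  slice_at (slice_conj Omega (vector_part Omega h)) a b
    (qconj (qvec (F0 (a, b)))) (qconj (qvec (F1 (a, b)))).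
Proof.
move=> Dab.
have sV : stem (stem_domain Omega) (@qvec R \o F0) (@qvec R \o F1).
  exact: (stem_linear oD continuous_qvec hstem).
have iV :
    Defs.induced Omega (@qvec R \o F0) (@qvec R \o F1) (vector_part Omega h).
  by move=> I x y SI Oxy; apply: slice_at_vector_part => //; exists I.
have : is_slice_conj Omega (vector_part Omega h)
    (slice_conj Omega (vector_part Omega h)).
  apply: (xgetPex (fun=> 0)).
  exists (induce (@qconj R \o @qvec R \o F0) (@qconj R \o @qvec R \o F1)).
  exists (@qvec R \o F0), (@qvec R \o F1); split=> //.
  apply: induced_induce => z Dz; have [/= -> ->] := stem_parity sV Dz.
  split => //; move: (qvec (F1 z)) => v.
  have [y0 [y1 [y2 [y3 ->]]]] := quat_mkq v.
  by rewrite mkqN !qconjE mkqN.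
move=> [G0 [G1 [sG iG icG]]].
have [<- <-] : G0 (a, b) = qvec (F0 (a, b)) /\ G1 (a, b) = qvec (F1 (a, b)).
  apply: slice_value_inj => I SI.
  by rewrite -(slice_at_vector_part Dab SI) (induced_slice_at circ iG Dab SI).
exact: induced_slice_at icG Dab.
Qed.

(** With [V + sqrt(-1) U] the vector part of the stem value, the symmetrization
    is [(V + sqrt(-1) U) (V^c + sqrt(-1) U^c)], and this complex number is
    the sum of the squares of the three complex coordinates. *)
Lemma slice_at_vector_sym a b (s := vector_square (F0 (a, b)) (F1 (a, b))) :
  stem_domain Omega (a, b) ->
  slice_at (vector_sym Omega h) a b (re s)%:A (im s)%:A.
Proof.
move=> Dab.
have := slice_at_star (slice_at_vector_part Dab) (slice_at_vector_conj Dab).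
rewrite /s vector_squareE /=.
have [p0 [p1 [p2 [p3 ->]]]] := quat_mkq (F0 (a, b)).
have [q0 [q1 [q2 [q3 ->]]]] := quat_mkq (F1 (a, b)).
have [_ -> -> ->] := mkqK p0 p1 p2 p3; have [_ -> -> ->] := mkqK q0 q1 q2 q3.
rewrite !qvec_mkq !qconjE !mkqM mkqN !mkqD mkq1 !mkqZ.
by congr slice_at; congr mkq; ring.
Qed.

End StemFunction.

End SliceDecomposition.

(** * Discretely valued functions on the stem domain *)

Section LocallyConstant.
Variable R : realType.
Local Notation H := (quat R).
Implicit Types (a b : R) (Omega : set H) (F : R * R -> H) (u : R * R -> R).

Lemma continuous_qnorm_qvec : continuous (fun q : H => qnorm (qvec q) : R).
Proof.
have csq l : continuous (fun q : H => q 0 l ^+ 2 : R).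
  move=> q; apply: (@continuous_comp _ _ _ (@qcoord R l) (fun x : R => x ^+ 2)).
    exact: continuous_qcoord.
  exact: exprn_continuous.
have cn : continuous (@qsqn R).
  move=> q; apply: (@cvgD _ R _ (nbhs q) (nbhs_filter q)
    (fun q : H => q 0 0 ^+ 2 + q 0 1 ^+ 2 + q 0 2 ^+ 2)
    (fun q : H => q 0 3 ^+ 2)).
    apply: (@cvgD _ R _ (nbhs q) (nbhs_filter q)
      (fun q : H => q 0 0 ^+ 2 + q 0 1 ^+ 2) (fun q : H => q 0 2 ^+ 2)).
      apply: (@cvgD _ R _ (nbhs q) (nbhs_filter q)
        (fun q : H => q 0 0 ^+ 2) (fun q : H => q 0 1 ^+ 2)).
        exact: csq.
      exact: csq.
    exact: csq.
  exact: csq.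
move=> q; apply: (@continuous_comp _ _ _ (@qvec R) (@qnorm R)).
  exact: continuous_qvec.
apply: (@continuous_comp _ _ _ (@qsqn R) (@Num.sqrt R)); first exact: cn.
exact: sqrt_continuous.
Qed.

Lemma derivable_line u z (v : R * R) (s : R) : derivable u (s *: v + z) v ->
  derivable (fun t : R => u (t *: v + z)) s 1.
Proof.
rewrite /derivable => du.
rewrite (_ : (fun h : R => h^-1 *: _) = (fun h : R => h^-1 *:
  ((u \o shift (s *: v + z)) (h *: v) - u (s *: v + z))))//.
apply/funext => t /=.
by rewrite addrA -scalerDl [t *: 1]mulr1.
Qed.

(** Otherwise the intermediate value theorem would provide a value halfway
    between two multiples of [kappa]. *)
Lemma discrete_constant (g : R -> R) (kappa x y : R) : 0 < kappa -> x <= y ->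
  (forall t, x <= t <= y -> derivable g t 1) ->
  (forall t, x <= t <= y -> exists k : int, g t = k%:~R * kappa) ->
  g x = g y.
Proof.
move=> k0 xy dg gk.
have cg : {within `[x, y], continuous g}.
  by apply: derivable_within_continuous => t; rewrite in_itv/=; exact: dg.
have [k gx] := gk x (introT andP (conj (lexx x) xy)).
have [l gy] := gk y (introT andP (conj xy (lexx y))).
have half (i j : int) : i%:~R * kappa < j%:~R * kappa ->
  i%:~R * kappa <= (i%:~R + 2^-1) * kappa <= j%:~R * kappa.
  rewrite ltr_pM2r// ltr_int => ij; rewrite !ler_pM2r//.
  have : (i + 1)%:~R <= j%:~R :> R by rewrite ler_int lezD1.
  by rewrite intrD; lra.
have nohalf (i : int) :
    ~ exists2 c, c \in `[x, y]%R & g c = (i%:~R + 2^-1) * kappa.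
  move=> [c]; rewrite in_itv/= => /gk[j ->] /(mulIf (lt0r_neq0 k0)).
  have [ij|ij] := leP j i.
    have : j%:~R <= i%:~R :> R by rewrite ler_int.
    lra.
  have : (i + 1)%:~R <= j%:~R :> R by rewrite ler_int lezD1.
  by rewrite intrD; lra.
have [gg|gg|//] := ltgtP (g x) (g y).
- exfalso; apply: (nohalf k); apply: IVT => //.
  rewrite (min_l (ltW gg)) (max_r (ltW gg)) gx gy.
  by apply: half; rewrite -gx -gy.
- exfalso; apply: (nohalf l); apply: IVT => //.
  rewrite (min_r (ltW gg)) (max_l (ltW gg)) gx gy.
  by apply: half; rewrite -gx -gy.
Qed.

Lemma discrete_constant_segment u (D : set (R * R)) (kappa : R) z v (x y : R) :
  0 < kappa ->
  (forall w, D w -> derivable u w v) ->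
  (forall w, D w -> exists k : int, u w = k%:~R * kappa) ->
  (forall t, `|t - x| <= `|y - x| -> D (t *: v + z)) ->
  u (x *: v + z) = u (y *: v + z).
Proof.
move=> k0 du uk Dt.
have [xy|/ltW yx] := leP x y.
  apply: (@discrete_constant (fun t : R => u (t *: v + z)) _ _ _ k0 xy) => t
    /andP[xt ty].
    by apply: derivable_line; apply: du; apply: Dt; rewrite !ger0_norm; lra.
  by apply: uk; apply: Dt; rewrite !ger0_norm; lra.
apply/esym.
apply: (@discrete_constant (fun t : R => u (t *: v + z)) _ _ _ k0 yx) => t
  /andP[xt ty].
  by apply: derivable_line; apply: du; apply: Dt; rewrite !ler0_norm; lra.
by apply: uk; apply: Dt; rewrite !ler0_norm; lra.
Qed.

(** A vertical segment followed by a horizontal one joins the centre to any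
    point of the box, so that derivability along the axes suffices. *)
Lemma discrete_constant_box u (D : set (R * R)) (kappa : R) (z : R * R) e a b :
  0 < kappa ->
  (forall w, D w -> derivable u w (1, 0) /\ derivable u w (0, 1)) ->
  (forall w, D w -> exists k : int, u w = k%:~R * kappa) ->
  (forall a b, `|a - z.1| < e -> `|b - z.2| < e -> D (a, b)) ->
  `|a - z.1| < e -> `|b - z.2| < e -> u z = u (a, b).
Proof.
case: z => [a0 b0] /= k0 du uk De ae be.
have hE (x y : R) : x *: (1, 0) + (0, y) = (x, y) :> R * R.
  rewrite [LHS]surjective_pairing /=; congr (_, _).
    by rewrite [x *: 1]mulr1 addr0.
  by rewrite scaler0 add0r.
have vE (x y : R) : y *: (0, 1) + (x, 0) = (x, y) :> R * R.
  rewrite [LHS]surjective_pairing /=; congr (_, _).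
    by rewrite scaler0 add0r.
  by rewrite [y *: 1]mulr1 addr0.
transitivity (u (a0, b)).
  rewrite -(vE a0 b0) -(vE a0 b).
  apply: (discrete_constant_segment k0 (D := D)) => [w /du[] //|//|t tb].
  by rewrite vE; apply: De; rewrite ?subrr ?normr0; apply: le_lt_trans be.
rewrite -(hE a0 b) -(hE a b).
apply: (discrete_constant_segment k0 (D := D)) => [w /du[] //|//|t ta].
by rewrite hE; apply: De => //; apply: le_lt_trans ae.
Qed.

(** The function [q |-> u (q_re q, qnorm (qvec q))] is locally constant by
    [discrete_constant_box], hence constant on the connected set [Omega]. *)
Lemma discrete_stem_constant Omega u (kappa : R) :
  domain Omega -> circular Omega -> 0 < kappa ->
  (forall z, stem_domain Omega z ->
    derivable u z (1, 0) /\ derivable u z (0, 1)) ->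
  (forall z, stem_domain Omega z -> exists k : int, u z = k%:~R * kappa) ->
  exists k : int, forall q, Omega q ->
    u (q_re q, qnorm (qvec q)) = k%:~R * kappa.
Proof.
move=> [[q0 Oq0] conn oO] circ k0 du uk.
pose U (q : H) := u (q_re q, qnorm (qvec q)).
have box q : Omega q -> \forall q' \near q, Omega q' /\ U q' = U q.
  move=> Oq; have Dq := stem_domain_abs circ Oq.
  have [e e0 De] := open_stem_domain_box circ oO Dq.
  have nre : \forall q' \near q, `|q_re q' - q_re q| < e.
    have /cvgrPdist_lt := @continuous_qcoord R 0 q => /(_ e e0).
    by apply: filterS => t; rewrite distrC.
  have nim : \forall q' \near q, `|qnorm (qvec q') - qnorm (qvec q)| < e.
    have /cvgrPdist_lt := @continuous_qnorm_qvec q => /(_ e e0).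
    by apply: filterS => t; rewrite distrC.
  near=> q'.
  have Oq' : Omega q' by near: q'; exact: open_nbhs_nbhs.
  split=> //.
  rewrite /U; apply/esym/(discrete_constant_box k0 du uk De); first by near: q'.
  by near: q'.
have [k Uk] := uk _ (stem_domain_abs circ Oq0).
exists k => q Oq; rewrite -Uk.
pose B := [set q | Omega q /\ U q = U q0].
have /seteqP[_ BO] : B = Omega.
  apply: conn.
  - by exists q0.
  - exists B; last by apply/seteqP; split => x /= => [[]|[]].
    rewrite openE => x [Ox Ux]; rewrite /interior; near=> y.
    have [] : Omega y /\ U y = U x by near: y; exact: box.
    by move=> Oy e; split => //; rewrite e.
  - exists (~` [set q | Omega q /\ U q != U q0]).
      apply: open_closedC; rewrite openE => x [Ox Ux]; rewrite /interior.
      near=> y.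
      have [] : Omega y /\ U y = U x by near: y; exact: box.
      by move=> Oy e; split => //; rewrite e.
    apply/seteqP; split => x /= [Ox].
      by move=> Ux; split => // -[_]; rewrite Ux eqxx.
    by move=> nU; split=> //; apply/eqP/negPn/negP => ne; apply: nU.
by have [] := BO q Oq.
Unshelve. all: by end_near.
Qed.

End LocallyConstant.

(** * Constancy of the integers attached to a star logarithm *)

Section Logarithms.
Local Open Scope complex_scope.
Variables (R : realType) (Omega : set (quat R)).
Hypotheses (dom : domain Omega) (circ : circular Omega).
Local Notation H := (quat R).
Local Notation re := (@complex.Re R).
Local Notation im := (@complex.Im R).
Local Notation D := (stem_domain Omega).
Implicit Types (a b : R) (h : H -> H) (F : R * R -> H).

Let oO : open Omega. Proof. by case: dom. Qed.

Lemma sqr_pi_inj (m n : int) : (m%:~R * pi) ^+ 2 = (n%:~R * pi) ^+ 2 :> R ->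
  m = n \/ m = - n.
Proof.
move=> e.
have : (m%:~R * pi == n%:~R * pi :> R) || (m%:~R * pi == - (n%:~R * pi) :> R).
  by rewrite -eqf_sqr; apply/eqP.
have pi0 : pi != 0 :> R by rewrite gt_eqF// pi_gt0.
rewrite -mulNr -mulrNz => /orP[|] /eqP /(mulIf pi0) /intr_inj; by [left|right].
Qed.

Lemma derivable_qcoord F z v l : derivable F z v ->
  derivable (fun w => F w 0 l : R) z v.
Proof. by move=> dF; case: (is_derive_linear (@continuous_qcoord R l) dF). Qed.

(** The integer [m] found on each sphere by [star_exp_slice_preserving] is
    determined up to sign by [s = (m pi)^2]; as [s] takes its values in the
    multiples of [pi^2] and is built from derivable functions, it is constant. *)
Lemma star_exp_vec_constant h F0 F1 :
  stem D F0 F1 -> Defs.induced Omega F0 F1 h ->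
  (forall I q, unit_sphere I -> Omega q -> slice_plane I q ->
     slice_plane I (star_exp h q)) ->
  exists m : int, forall a b
      (E := (-1) ^ m * cexp (scalar_part (F0 (a, b)) (F1 (a, b)))),
    D (a, b) ->
    [/\ vector_square (F0 (a, b)) (F1 (a, b)) = ((m%:~R * pi) ^+ 2)%:C,
        m = 0 -> qvec (F0 (a, b)) = 0 /\ qvec (F1 (a, b)) = 0 &
        slice_at (star_exp h) a b (re E)%:A (im E)%:A].
Proof.
move=> sF iF pF.
pose u (z : R * R) : R := re (vector_square (F0 z) (F1 z)).
have uE z : u z = q_i (F0 z) ^+ 2 + q_j (F0 z) ^+ 2 + q_k (F0 z) ^+ 2 -
    (q_i (F1 z) ^+ 2 + q_j (F1 z) ^+ 2 + q_k (F1 z) ^+ 2).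
  by rewrite /u vector_squareE.
have loc a b : D (a, b) -> exists m : int,
    let E := (-1) ^ m * cexp (scalar_part (F0 (a, b)) (F1 (a, b))) in
    [/\ vector_square (F0 (a, b)) (F1 (a, b)) = ((m%:~R * pi) ^+ 2)%:C,
        m = 0 -> qvec (F0 (a, b)) = 0 /\ qvec (F1 (a, b)) = 0 &
        slice_at (star_exp h) a b (re E)%:A (im E)%:A].
  move=> Dab; apply: star_exp_slice_preserving.
    exact: induced_slice_at iF Dab.
  move=> I SI; apply: pF => //; first exact/stem_domainP.
  by exists a, b.
have pi20 : 0 < pi ^+ 2 :> R by rewrite exprn_gt0// pi_gt0.
have du z : D z -> derivable u z (1, 0) /\ derivable u z (0, 1).
  move=> Dz; have [C0 C1 _] := sF.
  have [d0 d0' _ _] := C0 z Dz; have [d1 d1' _ _] := C1 z Dz.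
  have dv v : derivable F0 z v -> derivable F1 z v -> derivable u z v.
    pose p (F : R * R -> H) w : R :=
      q_i (F w) ^+ 2 + q_j (F w) ^+ 2 + q_k (F w) ^+ 2.
    have dp F : derivable F z v -> derivable (p F) z v.
      move=> dF.
      have dX (l : 'I_4) : derivable ((fun w => F w 0 l : R) ^+ 2) z v.
        by apply: derivableX; exact: derivable_qcoord.
      exact: (derivableD (derivableD (dX 1) (dX 2)) (dX 3)).
    move=> e0 e1; rewrite (_ : u = p F0 - p F1); last exact/funext/uE.
    by apply: derivableB; exact: dp.
  by split; [exact: (dv _ d0 d1)|exact: (dv _ d0' d1')].
have uk z : D z -> exists k : int, u z = k%:~R * pi ^+ 2.
  case: z => a b /loc[m [e _ _]]; exists (m ^+ 2).
  by rewrite /u e /= exprMn rmorphXn.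
have [K uK] := discrete_stem_constant dom circ pi20 du uk.
have uabs a b : D (a, b) -> u (a, b) = K%:~R * pi ^+ 2.
  move=> Dab; rewrite -(uK (a%:A + b *: qi R)); last first.
    by apply/stem_domainP => //; exact: unit_sphere_qi.
  have [-> -> ->] := slice_coords a b (unit_sphere_qi R).
  have [b0|b0] := leP 0 b; first by rewrite ger0_norm.
  rewrite ltr0_norm//; have [/= e0 e1] := stem_parity sF Dab.
  (* [s] has even real part: conjugating the stem variable changes the sign of
     the odd component only *)
  rewrite !uE e0 e1.
  by rewrite /q_i /q_j /q_k !mxE !sqrrN.
have [[q0 Oq0] _ _] := dom.
have [m [em _ _]] := loc _ _ (stem_domain_abs circ Oq0).
have Km : K%:~R * pi ^+ 2 = (m%:~R * pi) ^+ 2 :> R by rewrite -(uK _ Oq0) /u em.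
exists m => a b E Dab; rewrite {}/E; have [m' [em' zm' xm']] := loc a b Dab.
have uab := uabs a b Dab; rewrite /u em' /= Km in uab.
have [<-|m'E] := sqr_pi_inj uab; first by split.
rewrite m'E in em' zm' xm'; split.
- by rewrite em' mulrNz mulNr sqrrN.
- by move=> m0; apply: zm'; rewrite m0 oppr0.
- by move: xm'; rewrite /= -exprz_inv invrN1.
Qed.

Lemma stem_real_axis F0 F1 a : stem D F0 F1 -> D (a, 0) -> F1 (a, 0) = 0.
Proof.
move=> sF Da; have [/= _ e1] := stem_parity sF Da; rewrite oppr0 in e1.
exact: quat_eq_oppr.
Qed.

(** On each sphere [(-1)^m e^w = (-1)^mt e^w'] forces [w - w'] to be
    [(2 k + mt - m) pi sqrt(-1)] for some integer [k].  The imaginary part of the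
    difference is a stem component with values in the multiples of [pi], hence
    constant on the points with nonnegative second coordinate. *)
Lemma log_difference h ht F0 F1 G0 G1 (m mt : int) :
  stem D F0 F1 -> stem D G0 G1 ->
  {in Omega, star_exp h =1 star_exp ht} ->
  (forall a b (E := (-1) ^ m * cexp (scalar_part (F0 (a, b)) (F1 (a, b)))),
    D (a, b) ->
    slice_at (star_exp h) a b (re E)%:A (im E)%:A) ->
  (forall a b (E := (-1) ^ mt * cexp (scalar_part (G0 (a, b)) (G1 (a, b)))),
    D (a, b) ->
    slice_at (star_exp ht) a b (re E)%:A (im E)%:A) ->
  exists n : int, (exists k : int, n = 2 * k + mt - m) /\
    forall q (z := (q_re q, qnorm (qvec q))), Omega q ->
      q_re (F0 z) = q_re (G0 z) /\ q_re (F1 z) = q_re (G1 z) + n%:~R * pi.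
Proof.
move=> sF sG hexp eF eG.
have loc z : D z -> exists k : int, q_re (F0 z) = q_re (G0 z) /\
    q_re (F1 z) = q_re (G1 z) + (2 * k + mt - m)%:~R * pi.
  case: z => a b Dab.
  set E := (-1) ^ m * cexp (scalar_part (F0 (a, b)) (F1 (a, b))).
  set E' := (-1) ^ mt * cexp (scalar_part (G0 (a, b)) (G1 (a, b))).
  have [] : ((re E)%:A : H) = (re E')%:A /\ ((im E)%:A : H) = (im E')%:A.
    apply: slice_value_inj => I SI.
    rewrite -(eF a b Dab I SI) -(eG a b Dab I SI); apply: hexp.
    by rewrite inE; apply/stem_domainP.
  have algI (x y : R) : x%:A = y%:A :> H -> x = y.
    move=> /eqP; rewrite -subr_eq0 -scalerBl scaler_eq0 oner_eq0 orbF subr_eq0.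
    by move/eqP.
  move=> /algI er /algI ei.
  have : E = E'.
    by apply/eqP; rewrite eq_complex er ei !eqxx.
  rewrite /E /E' -!cexp_pi -!cexpD => e.
  have /cexp_eq1[k /eqP] :
      cexp (0 +i* (m%:~R * pi) + scalar_part (F0 (a, b)) (F1 (a, b)) -
        (0 +i* (mt%:~R * pi) + scalar_part (G0 (a, b)) (G1 (a, b)))) = 1.
    by rewrite cexpD e cexpN.
  rewrite eq_complex /= => /andP[/eqP e0 /eqP e1]; exists k; split; first lra.
  by move: e1; rewrite intrB intrD !intrM; lra.
pose u (z : R * R) : R := q_re (F1 z) - q_re (G1 z).
have du z : D z -> derivable u z (1, 0) /\ derivable u z (0, 1).
  have [[_ CF _] [_ CG _]] := (sF, sG).
  move=> Dz; have [d0 d0' _ _] := CF z Dz; have [d1 d1' _ _] := CG z Dz.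
  by split; apply: derivableB; exact: (@derivable_qcoord _ _ _ 0).
have uk z : D z -> exists k : int, u z = k%:~R * pi.
  move=> /loc[k [_ e]]; exists (2 * k + mt - m).
  by rewrite /u e addrAC subrr add0r.
have [n un] := discrete_stem_constant dom circ (pi_gt0 R) du uk.
have [[q0 Oq0] _ _] := dom.
exists n; split=> [|q z Oq].
  have [k [_ e]] := loc _ (stem_domain_abs circ Oq0); exists k.
  have := un _ Oq0; rewrite /u e addrAC subrr add0r.
  move=> /(mulIf _) /intr_inj -> //.
  by rewrite gt_eqF// pi_gt0.
have [k [e0 _]] := loc _ (stem_domain_abs circ Oq).
by rewrite -(un _ Oq) /u e0; split=> //; rewrite addrC subrK.
Qed.

End Logarithms.

(** * Two logarithms of the same slice preserving function *)

Section MainParts.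
Local Open Scope complex_scope.
Variables (R : realType) (Omega : set (quat R)).
Hypotheses (dom : domain Omega) (circ : circular Omega).
Local Notation H := (quat R).
Local Notation D := (stem_domain Omega).
Implicit Types (h : H -> H).

Let oO : open Omega. Proof. by case: dom. Qed.

Lemma vector_sym_constant h F0 F1 (m : int) :
  stem D F0 F1 -> Defs.induced Omega F0 F1 h ->
  (forall a b, D (a, b) ->
    vector_square (F0 (a, b)) (F1 (a, b)) = ((m%:~R * pi) ^+ 2)%:C) ->
  {in Omega, forall q, vector_sym Omega h q = ((m%:~R * pi) ^+ 2)%:A}.
Proof.
move=> sF iF cF q; rewrite inE => Oq; have Dq := stem_domain_abs circ Oq.
have [I SI {1}->] := slice_decomp q.
rewrite (slice_at_vector_sym circ oO sF iF Dq SI) (cF _ _ Dq) /=.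
by rewrite scale0r mulr0 addr0.
Qed.

Lemma frakN_of_constant h F0 F1 (m : int) :
  stem D F0 F1 -> Defs.induced Omega F0 F1 h ->
  (forall a b, D (a, b) ->
    vector_square (F0 (a, b)) (F1 (a, b)) = ((m%:~R * pi) ^+ 2)%:C) ->
  (forall a b, D (a, b) -> m = 0 ->
    qvec (F0 (a, b)) = 0 /\ qvec (F1 (a, b)) = 0) ->
  frakN Omega h.
Proof.
move=> sF iF cF zF; have [m0|m0] := eqVneq m 0.
  by right; apply: (slice_preserving_of_real sF iF) => -[a b] Dab; exact: zF.
left; split; first by exists F0, F1.
by exists m; split => //; exact: (vector_sym_constant sF iF cF).
Qed.

(** Each of the four choices of signs changes [m] or [mt] by an even amount, so
    the congruence always reduces to the parity of [n - mt + m]. *)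
Lemma sqrt_congr_of_constant h ht (m mt n k : int) :
  n = 2 * k + mt - m ->
  {in Omega, forall q, vector_sym Omega h q = ((m%:~R * pi) ^+ 2)%:A} ->
  {in Omega, forall q, vector_sym Omega ht q = ((mt%:~R * pi) ^+ 2)%:A} ->
  sqrt_congr Omega h ht (n%:~R * pi).
Proof.
move=> nE hm htm; split.
- by exists (m%:~R * pi); split=> //; exists m.
- by exists (mt%:~R * pi); split=> //; exists mt.
have [[q0 Oq0] _ _] := dom; have {}Oq0 : q0 \in Omega by rewrite inE.
have root f (p : int) s :
    {in Omega, forall q, vector_sym Omega f q = ((p%:~R * pi) ^+ 2)%:A} ->
    const_sqrt Omega f s -> s = p%:~R * pi \/ s = (- p)%:~R * pi.
  move=> fp [[p' ->] fs].
  have /eqP : (((p'%:~R * pi) ^+ 2)%:A : H) = ((p%:~R * pi) ^+ 2)%:A.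
    by rewrite -(fs q0 Oq0) fp.
  rewrite -subr_eq0 -scalerBl scaler_eq0 oner_eq0 orbF subr_eq0 => /eqP.
  by move=> /sqr_pi_inj[->|->]; [left|right].
move=> s t /(root _ _ _ hm)[|] -> /(root _ _ _ htm)[|] ->; rewrite nE.
- by exists (m - mt - k); rewrite !(intrD, intrM, mulrNz); ring.
- by exists (m - k); rewrite !(intrD, intrM, mulrNz); ring.
- by exists (- mt - k); rewrite !(intrD, intrM, mulrNz); ring.
- by exists (- k); rewrite !(intrD, intrM, mulrNz); ring.
Qed.

(** A real point of [Omega] forces [n = 0], since odd stem components vanish on
    the real axis.  At every other point [calJ q] is the unit [I] of [q], which
    turns the difference of imaginary parts into a multiple of [calJ]. *)
Lemma logarithms_of_slice_preserving h ht :
  slice_regular Omega h -> slice_regular Omega ht ->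
  {in Omega, star_exp h =1 star_exp ht} ->
  slice_preserving Omega (star_exp h) ->
  exists n : int, [/\ slice_domain Omega -> n = 0,
    {in Omega, forall q,
      real_part Omega h q = real_part Omega ht q + (pi * n%:~R) *: calJ q},
    frakN Omega h, frakN Omega ht & sqrt_congr Omega h ht (n%:~R * pi)].
Proof.
move=> [F0 [F1 [sF iF]]] [G0 [G1 [sG iG]]] hexp [_ hpres].
have pF I q : unit_sphere I -> Omega q -> slice_plane I q ->
    slice_plane I (star_exp h q).
  by move=> SI Oq Iq; apply: hpres => //; exists q.
have pG I q : unit_sphere I -> Omega q -> slice_plane I q ->
    slice_plane I (star_exp ht q).
  by move=> SI Oq Iq; rewrite -hexp ?inE//; exact: pF.
have [m mF] := star_exp_vec_constant dom circ sF iF pF.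
have [mt mG] := star_exp_vec_constant dom circ sG iG pG.
have [n [[k nE] nFG]] := log_difference dom circ sF sG hexp
  (fun a b Dab => let: And3 _ _ e := mF a b Dab in e)
  (fun a b Dab => let: And3 _ _ e := mG a b Dab in e).
have cF a b : D (a, b) ->
    vector_square (F0 (a, b)) (F1 (a, b)) = ((m%:~R * pi) ^+ 2)%:C.
  by move=> /mF[].
have cG a b : D (a, b) ->
    vector_square (G0 (a, b)) (G1 (a, b)) = ((mt%:~R * pi) ^+ 2)%:C.
  by move=> /mG[].
have n0_real q : Omega q -> qnorm (qvec q) = 0 -> n = 0.
  move=> Oq v0; have Dq := stem_domain_abs circ Oq.
  have [_] := nFG q Oq; rewrite v0 in Dq *.
  rewrite (stem_real_axis sF Dq) (stem_real_axis sG Dq) => e.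
  have /eqP : n%:~R * pi = 0 :> R by lra.
  by rewrite mulf_eq0 (gt_eqF (pi_gt0 R)) orbF intr_eq0 => /eqP.
exists n; split.
- move=> [q [Oq [a _ aE]]]; apply: (n0_real a%:A); first by rewrite aE.
  have [_ + +] := slice_coords a 0 (unit_sphere_qi R).
  by rewrite scale0r addr0 normr0 => ->.
- move=> q; rewrite inE => Oq; have Dq := stem_domain_abs circ Oq.
  have [e0 e1] := nFG q Oq.
  have [I SI qE] := slice_decomp q.
  have rF := slice_at_real_part circ oO sF iF Dq SI.
  have rG := slice_at_real_part circ oO sG iG Dq SI.
  rewrite -qE in rF rG; rewrite rF rG e0 e1 scalerDl mulrDr addrA.
  have [v0|v0] := eqVneq (qnorm (qvec q)) 0.
    by rewrite (n0_real q Oq v0) mul0r mulr0 !scale0r mulr0.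
  have -> : calJ q = I.
    have [_ vE _] := slice_coords (q_re q) (qnorm (qvec q)) SI.
    rewrite -qE in vE.
    by rewrite /calJ {2}vE scalerA mulVf// scale1r.
  by congr (_ + _); rewrite mulr_algr mulrC.
- exact: (frakN_of_constant sF iF cF
    (fun a b Dab => let: And3 _ z _ := mF a b Dab in z)).
- exact: (frakN_of_constant sG iG cG
    (fun a b Dab => let: And3 _ z _ := mG a b Dab in z)).
- apply: (sqrt_congr_of_constant nE).
    exact: (vector_sym_constant sF iF cF).
  exact: (vector_sym_constant sG iG cG).
Qed.

End MainParts.

Theorem theorem1p1 (R : realType) (Omega : set (quat R)) (h ht : quat R -> quat R)
    (hdom : domain Omega) (hcirc : circular Omega)
    (hreg : slice_regular Omega h) (htreg : slice_regular Omega ht)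
    (hexp : {in Omega, star_exp h =1 star_exp ht})
    (hpres : slice_preserving Omega (star_exp h)) :
  (slice_domain Omega ->
    [/\ {in Omega, real_part Omega h =1 real_part Omega ht},
        frakN Omega h, frakN Omega ht &
        sqrt_congr Omega h ht 0]) /\
  (product_domain Omega ->
    exists n : int,
    [/\ {in Omega, forall q,
           real_part Omega h q = real_part Omega ht q + (pi * n%:~R) *: calJ q},
        frakN Omega h, frakN Omega ht &
        sqrt_congr Omega h ht (n%:~R * pi)]).

Proof.
have [n [n0 real_parts hN htN sqrts]] :=
  logarithms_of_slice_preserving hdom hcirc hreg htreg hexp hpres.
split=> [sd|_]; last by exists n.
rewrite (n0 sd) mul0r in sqrts; split=> // q Oq.
by rewrite (real_parts q Oq) (n0 sd) mulr0 scale0r addr0.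
Qed.
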